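(* Let $(d_n)_{n\ge0}$ be a sequence of complex numbers such that $$|d_n|\le M\frac{(2n)!}{R^{2n}}\quad\forall n\in\mathbb{N}$$ for some constants $M>0$ and $R>1$, and such that the function $$g(z):=\sum_{n\ge0}\frac{d_{n+1}}{n!\,(n+1)!}z^n,\quad |z|<R^2/4,$$ can be extended as an analytic function in an open neighborhood of $\mathbb{R}_-=(-\infty,0]$ in $\mathbb{C}$ with $$|g^{(n)}(z)|\le C|g^{(n)}(0)|\quad\forall z\in\mathbb{R}_-,\ \forall n\in\mathbb{N}$$ for some constant $C>0$. Let $-\infty<T_1<T_2<\infty$. Then there exists a function $f\in C^\infty([T_1,T_2],\mathbb{C})$ such that $$f^{(n)}(T_1)=0\quad\forall n\ge0,\qquad f^{(n)}(T_2)=d_n\quad\forall n\ge0,$$ $$|f^{(n)}(t)|\le M'\frac{(2n)!}{R^{2n}}\quad\forall n\ge0,\ \forall t\in[T_1,T_2]$$ for some $M'>0$ and the same constant $R>1$ as in the bound on $(d_n)$. *)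

(* Defs.v *)
From Stdlib Require Import Reals Factorial.
From Coquelicot Require Import Coquelicot.
Open Scope R_scope.

Definition g_coeff (d : nat -> C) (n : nat) : C :=
  (d (S n) / RtoC (INR (fact n) * INR (fact (S n))))%C.

Definition analytic_on (U : C -> Prop) (G : C -> C) : Prop :=
  forall z0 : C, U z0 ->
    exists a : nat -> C,
      locally z0 (fun z : C =>
        @is_pseries C_AbsRing C_NormedModule a (z - z0)%C (G z)).

(* [C_derive] is a total operator; its iterates are the genuine complex
   derivatives wherever the function is analytic. *)
Definition C_derive_n (G : C -> C) (n : nat) : C -> C :=
  Nat.iter n C_derive G.

(* Derivative relative to D: one-sided at an endpoint when D is a closed
   interval. *)
Definition is_derive_within (D : R -> Prop) (f : R -> C) (t : R) (l : C) : Prop :=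
  @filterdiff R_AbsRing R_NormedModule C_R_NormedModule
    f (within D (locally t)) (fun h : R => @scal R_Ring C_R_ModuleSpace h l).

(* f is infinitely differentiable on D, with n-th derivative Df n on D.
   When D has no isolated point, f determines each Df n on D. *)
Definition smooth_on (D : R -> Prop) (f : R -> C) (Df : nat -> R -> C) : Prop :=
  (forall t : R, D t -> Df O t = f t) /\
  (forall (n : nat) (t : R), D t -> is_derive_within D (Df n) t (Df (S n) t)).

(* Main.v *)
(* Let [v] be the antiderivative of [g] with [v(0) = d_0], so that [v^(n)(0) = d_n / n!].  The
   Borel-Laplace sum [t |-> int_0^oo e^-s v(ts) ds] has, for [t <= 0], the n-th derivative
   [int_0^oo e^-s s^n v^(n)(ts) ds]; for [n >= 1] the hypothesis on [g] bounds it by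
   [n! K |v^(n)(0)| = K |d_n|], and at [t = 0] it equals [d_n].

   Translated by [T2], this function is multiplied by a cutoff vanishing to infinite order at
   [T1] and equal to 1 up to infinite order at [T2].  The constant [R] survives because
   [C(n,k) (2k)! (2(n-k))! <= (2n)!]: if the cutoff has derivatives bounded by [N b^k (2k)!] with
   [b <= R^-2 / 2], the Leibniz sum is dominated by a geometric series.  Such cutoffs with [b]
   arbitrarily small come from [exp(-lam/x)] with [lam] large, whose k-th derivative is at most
   [(2/lam)^k (2k)!]. *)

Require Import Defs.
From Stdlib Require Import Reals Factorial Lra Lia.
From Coquelicot Require Import Coquelicot.
Open Scope R_scope.

(** * A flat function *)

(** The Taylor coefficients [d n / n!] prescribed at [T2] may grow like [(2n)! / n!], so the Taylor
    series there may diverge for every [t <> T2]. One more division by [n!] gives a series with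
    positive radius of convergence, and the weight [e^-s] restores the lost factorial. Control on
    the negative half-line alone is enough because the interval lies to the left of [T2]. The
    delicate point is to keep [R] unchanged. A cutoff of the same rate as the Laplace integral would
    leave [n + 1] comparable terms in the Leibniz bound and cost a factor [n + 1]. A rate smaller by
    a factor 2 costs only a constant, and the same device bounds the product of exponentials from
    which the cutoff is built. All of this is done for real functions. The complex part only relates
    the iterates of [C_derive] to power series coefficients and to derivatives along the real line;
    real and imaginary parts are then treated separately, at the price of a larger constant but not
    of a different rate. *)

(** The factor [(/ x) ^ m] makes the family closed under differentiation: the derivative at index
    [m] is a combination of those at [m + 1] and [m + 2]. *)
Definition flat_exp (lam : R) (m : nat) (x : R) : R :=
  if Rlt_dec 0 x then (/ x) ^ m * exp (- (lam * / x)) else 0.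

(** A single term of the exponential series, [(lam y)^m / m!], is at most [exp (lam y)]. *)
Lemma pow_mul_exp_neg_le (lam y : R) (m : nat) :
  0 < lam -> 0 <= y -> y ^ m * exp (- (lam * y)) <= INR (fact m) / lam ^ m.
Proof.
  intros hl hy.
  assert (h : (lam * y) ^ m / INR (fact m) <= exp (lam * y)).
  { assert (h0 : 0 <= lam * y) by nra.
    eapply Rle_trans; [| apply (exp_ge_taylor _ m h0)].
    destruct m as [|m]; [simpl; lra|].
    rewrite tech5.
    assert (0 <= sum_f_R0 (fun k => (lam * y) ^ k / INR (fact k)) m).
    { apply cond_pos_sum. intros k. apply Rdiv_le_0_compat.
      - now apply pow_le.
      - apply INR_fact_lt_0. }
    lra. }
  rewrite Rpow_mult_distr in h.
  rewrite exp_Ropp.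
  assert (hf := INR_fact_lt_0 m).
  assert (hlm : 0 < lam ^ m) by now apply pow_lt.
  assert (he := exp_pos (lam * y)).
  apply Rmult_le_reg_r with (exp (lam * y) * lam ^ m); [now apply Rmult_lt_0_compat|].
  replace (y ^ m * / exp (lam * y) * (exp (lam * y) * lam ^ m)) with (lam ^ m * y ^ m)
    by (field; lra).
  replace (INR (fact m) / lam ^ m * (exp (lam * y) * lam ^ m))
    with (INR (fact m) * exp (lam * y)) by (field; lra).
  apply Rmult_le_reg_r with (/ INR (fact m)); [now apply Rinv_0_lt_compat|].
  replace (INR (fact m) * exp (lam * y) * / INR (fact m)) with (exp (lam * y)) by (field; lra).
  exact h.
Qed.

Lemma flat_exp_bounds (lam : R) (m : nat) (x : R) :
  0 < lam -> 0 <= flat_exp lam m x <= INR (fact m) / lam ^ m.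
Proof.
  intros hl. unfold flat_exp. destruct (Rlt_dec 0 x) as [hx|hx].
  - assert (0 < / x) by now apply Rinv_0_lt_compat.
    split.
    + apply Rmult_le_pos; [apply pow_le; lra | left; apply exp_pos].
    + apply pow_mul_exp_neg_le; lra.
  - split; [lra|]. apply Rdiv_le_0_compat; [left; apply INR_fact_lt_0 | now apply pow_lt].
Qed.

Lemma is_derive_flat_exp (lam : R) (m : nat) (x : R) :
  0 < lam ->
  is_derive (flat_exp lam m) x
    (- INR m * flat_exp lam (S m) x + lam * flat_exp lam (S (S m)) x).
Proof.
  intros hl. destruct (Rtotal_order 0 x) as [hx|[hx|hx]].
  - apply is_derive_ext_loc with (fun x => (/ x) ^ m * exp (- (lam * / x))).
    + exists (mkposreal x hx). intros y hy. unfold flat_exp.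
      assert (0 < y).
      { change (Rabs (y - x) < x) in hy. apply Rabs_def2 in hy. lra. }
      destruct (Rlt_dec 0 y); [reflexivity | lra].
    + unfold flat_exp. destruct (Rlt_dec 0 x); [|lra].
      auto_derive; [repeat split; lra|].
      destruct m as [|m]; [simpl; field; lra|].
      change (Nat.pred (S m)) with m. rewrite <- !tech_pow_Rmult. field. lra.
  - subst x.
    replace (- INR m * flat_exp lam (S m) 0 + lam * flat_exp lam (S (S m)) 0) with 0
      by (unfold flat_exp; destruct (Rlt_dec 0 0); lra).
    apply is_derive_Reals. intros eps heps.
    set (B := INR (fact (S (S m))) / lam ^ S (S m)).
    assert (hB : 0 < B) by (apply Rdiv_lt_0_compat; [apply INR_fact_lt_0 | now apply pow_lt]).
    assert (hd : 0 < eps / B) by now apply Rdiv_lt_0_compat.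
    exists (mkposreal _ hd). intros h hh hlt. simpl in hlt.
    assert (h0 : flat_exp lam m 0 = 0) by (unfold flat_exp; destruct (Rlt_dec 0 0); lra).
    rewrite Rplus_0_l, h0, !Rminus_0_r.
    (* Raising the index by two releases a factor [h^2], while the bound at the higher index is
       uniform; hence the difference quotient at 0 is [O(h)]. *)
    assert (hE : flat_exp lam m h = flat_exp lam (S (S m)) h * h * h).
    { unfold flat_exp. destruct (Rlt_dec 0 h); [|ring]. simpl. field. lra. }
    rewrite hE.
    replace (flat_exp lam (S (S m)) h * h * h / h) with (flat_exp lam (S (S m)) h * h)
      by (field; lra).
    destruct (flat_exp_bounds lam (S (S m)) h hl) as [h1 h2]. fold B in h2.
    rewrite Rabs_mult, (Rabs_pos_eq _ h1).
    apply Rle_lt_trans with (B * Rabs h).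
    + apply Rmult_le_compat_r; [apply Rabs_pos | exact h2].
    + apply Rlt_le_trans with (B * (eps / B)); [now apply Rmult_lt_compat_l|].
      right. field. lra.
  - apply is_derive_ext_loc with (fun _ => 0).
    + exists (mkposreal (- x) ltac:(lra)). intros y hy. unfold flat_exp.
      change (Rabs (y - x) < - x) in hy. apply Rabs_def2 in hy.
      destruct (Rlt_dec 0 y); [lra | reflexivity].
    + unfold flat_exp. destruct (Rlt_dec 0 x); [lra|].
      replace (- INR m * 0 + lam * 0) with 0 by ring.
      apply (@is_derive_const R_AbsRing R_NormedModule).
Qed.

(** The [k]-th derivative of [flat_exp lam m]. The recursion shifts the index [m] instead of
    differentiating the previous stage, so linearity is all that the next lemma needs. *)
Fixpoint flat_exp_diff (lam : R) (k m : nat) (x : R) : R :=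
  match k with
  | O => flat_exp lam m x
  | S k => - INR m * flat_exp_diff lam k (S m) x + lam * flat_exp_diff lam k (S (S m)) x
  end.

Lemma is_derive_flat_exp_diff (lam : R) (k m : nat) (x : R) :
  0 < lam -> is_derive (flat_exp_diff lam k m) x (flat_exp_diff lam (S k) m x).
Proof.
  intros hl. revert m. induction k as [|k IH]; intros m.
  - now apply is_derive_flat_exp.
  - change (flat_exp_diff lam (S (S k)) m x) with
      (- INR m * flat_exp_diff lam (S k) (S m) x + lam * flat_exp_diff lam (S k) (S (S m)) x).
    apply (@is_derive_plus R_AbsRing R_NormedModule);
      apply is_derive_scal; apply IH.
Qed.

Lemma flat_exp_diff_nonpos (lam : R) (k m : nat) (x : R) :
  x <= 0 -> flat_exp_diff lam k m x = 0.
Proof.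
  intros hx. revert m. induction k as [|k IH]; intros m; simpl.
  - unfold flat_exp. destruct (Rlt_dec 0 x); lra.
  - rewrite !IH. ring.
Qed.

(** Each differentiation yields two terms. The one with coefficient [lam] gains the factor
    [m + 2k + 2] from the factorial, and the other has coefficient [m], which is smaller; so the
    bound at most doubles relative to the larger term, whence [2 ^ k]. *)
Lemma flat_exp_diff_bound (lam : R) (k m : nat) (x : R) :
  0 < lam ->
  Rabs (flat_exp_diff lam k m x) <= 2 ^ k * (INR (fact (m + 2 * k)) / lam ^ (m + k)).
Proof.
  intros hl. revert m. induction k as [|k IH]; intros m.
  - simpl. rewrite !Nat.add_0_r, Rmult_1_l.
    destruct (flat_exp_bounds lam m x hl). rewrite Rabs_pos_eq; lra.
  - simpl flat_exp_diff. eapply Rle_trans; [apply Rabs_triang|].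
    rewrite !Rabs_mult, Rabs_Ropp, (Rabs_pos_eq _ (pos_INR m)), (Rabs_pos_eq lam) by lra.
    assert (hm := pos_INR m).
    apply Rle_trans with
      (INR m * (2 ^ k * (INR (fact (S m + 2 * k)) / lam ^ (S m + k)))
       + lam * (2 ^ k * (INR (fact (S (S m) + 2 * k)) / lam ^ (S (S m) + k)))).
    + apply Rplus_le_compat; apply Rmult_le_compat_l; try lra; apply IH.
    + replace (m + 2 * S k)%nat with (S (S m + 2 * k)) by lia.
      replace (S (S m) + 2 * k)%nat with (S (S m + 2 * k)) by lia.
      replace (S (S m) + k)%nat with (S (S m + k)) by lia.
      replace (m + S k)%nat with (S m + k)%nat by lia.
      rewrite fact_simpl, mult_INR.
      assert (hp : 0 < lam ^ (S m + k)) by now apply pow_lt.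
      assert (h2 : 0 < 2 ^ k) by (apply pow_lt; lra).
      assert (hf := INR_fact_lt_0 (S m + 2 * k)).
      assert (hmk : INR m <= INR (S (S m + 2 * k))) by (apply le_INR; lia).
      rewrite <- !tech_pow_Rmult.
      set (P := lam ^ (S m + k)) in *. set (F := INR (fact (S m + 2 * k))) in *.
      set (N := INR (S (S m + 2 * k))) in *.
      replace (lam * (2 ^ k * (N * F / (lam * P)))) with (N * (2 ^ k * (F / P)))
        by (field; lra).
      replace (2 * 2 ^ k * (N * F / P)) with (N * (2 ^ k * (F / P)) + N * (2 ^ k * (F / P)))
        by (field; lra).
      apply Rplus_le_compat_r, Rmult_le_compat_r; [|exact hmk].
      apply Rmult_le_pos; [lra|]. apply Rdiv_le_0_compat; lra.
Qed.

(** * Products of Gevrey functions *)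

Definition derivs_on (D : R -> Prop) (f : nat -> R -> R) : Prop :=
  forall n t, D t -> D_in (f n) (f (S n)) D t.

Lemma binomial_sum_step (h : nat -> R) (n : nat) :
  sum_f_R0 (fun k => Binomial.C n k * h k) n + sum_f_R0 (fun k => Binomial.C n k * h (S k)) n
  = sum_f_R0 (fun k => Binomial.C (S n) k * h k) (S n).
Proof.
  destruct n as [|m].
  - simpl. unfold Binomial.C. simpl. field.
  - rewrite (decomp_sum (fun k => Binomial.C (S m) k * h k)) by lia.
    rewrite (decomp_sum (fun k => Binomial.C (S (S m)) k * h k)) by lia.
    simpl Nat.pred. rewrite !tech5.
    assert (e : sum_f_R0 (fun i => Binomial.C (S (S m)) (S i) * h (S i)) m
      = sum_f_R0 (fun i => Binomial.C (S m) (S i) * h (S i)) m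
        + sum_f_R0 (fun k => Binomial.C (S m) k * h (S k)) m).
    { rewrite <- plus_sum. apply sum_eq. intros i hi. rewrite <- (pascal (S m) i) by lia. ring. }
    rewrite e.
    assert (c0 : forall n, Binomial.C n 0 = 1).
    { intros n. unfold Binomial.C. rewrite Nat.sub_0_r. simpl. field. apply INR_fact_neq_0. }
    assert (cn : forall n, Binomial.C n n = 1).
    { intros n. unfold Binomial.C. rewrite Nat.sub_diag. simpl. field. apply INR_fact_neq_0. }
    rewrite !c0, !cn. ring.
Qed.

(** The [n]-th derivative of the product of [f i] and [g j], kept as a tree of product rules:
    differentiability then follows from the structure, and the binomial form is derived in [leibniz]
    for the places that need the sum. The offsets [i] and [j] make the induction go through. *)
Fixpoint prod_diff (f g : nat -> R -> R) (n i j : nat) (t : R) : R :=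
  match n with
  | O => f i t * g j t
  | S n => prod_diff f g n (S i) j t + prod_diff f g n i (S j) t
  end.

Lemma D_in_prod_diff (D : R -> Prop) (f g : nat -> R -> R) (n i j : nat) (t : R) :
  derivs_on D f -> derivs_on D g -> D t ->
  D_in (prod_diff f g n i j) (prod_diff f g (S n) i j) D t.
Proof.
  intros hf hg ht. revert i j. induction n as [|n IH]; intros i j.
  - apply (Dmult D (f (S i)) (g (S j)) (f i) (g j)); [now apply hf | now apply hg].
  - apply (Dadd D (prod_diff f g (S n) (S i) j) (prod_diff f g (S n) i (S j))); apply IH.
Qed.

Lemma leibniz (f g : nat -> R -> R) (n i j : nat) (t : R) :
  prod_diff f g n i j t
  = sum_f_R0 (fun k => Binomial.C n k * (f (i + (n - k))%nat t * g (j + k)%nat t)) n.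
Proof.
  revert i j. induction n as [|n IH]; intros i j.
  - simpl. unfold Binomial.C. simpl. rewrite !Nat.add_0_r. field.
  - simpl prod_diff. rewrite !IH, <- binomial_sum_step. f_equal; apply sum_eq; intros k hk.
    + now replace (S i + (n - k))%nat with (i + (S n - k))%nat by lia.
    + now replace (i + (S n - S k))%nat with (i + (n - k))%nat by lia;
        replace (j + S k)%nat with (S j + k)%nat by lia.
Qed.

Lemma prod_diff_zero_r (f g : nat -> R -> R) (t : R) :
  (forall j, g j t = 0) -> forall n i j, prod_diff f g n i j t = 0.
Proof.
  intros hg n. induction n as [|n IH]; intros i j; simpl.
  - rewrite hg. ring.
  - rewrite !IH. ring.
Qed.

(** Every branch that differentiates [g] vanishes; the one surviving branch puts all [n] derivatives
    on [f]. *)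
Lemma prod_diff_flat_r (f g : nat -> R -> R) (t : R) :
  g O t = 1 -> (forall j, g (S j) t = 0) -> forall n i, prod_diff f g n i O t = f (i + n)%nat t.
Proof.
  intros h0 hS.
  assert (hz : forall n i j, prod_diff f g n i (S j) t = 0).
  { intros n. induction n as [|n IH]; intros i j; simpl; [rewrite hS; ring | rewrite !IH; ring]. }
  intros n. induction n as [|n IH]; intros i; simpl.
  - rewrite h0, Nat.add_0_r. ring.
  - rewrite IH, hz, Rplus_0_r. f_equal. lia.
Qed.

(* [(2k)!/k!] is supermultiplicative, since its successive ratios [2(2k+1)] increase. *)
Lemma fact_double_supermul (k m : nat) :
  (fact (k + m) * (fact (2 * k) * fact (2 * m)) <= fact k * fact m * fact (2 * (k + m)))%nat.
Proof.
  induction k as [|k IH]; [simpl Nat.add; simpl (fact 0); simpl (fact (2 * 0)); nia|].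
  replace (2 * S k)%nat with (S (S (2 * k))) by lia.
  replace (2 * (S k + m))%nat with (S (S (2 * (k + m)))) by lia.
  replace (S k + m)%nat with (S (k + m)) by lia.
  rewrite !fact_simpl.
  set (A := fact (k + m)) in *. set (B := fact (2 * k)) in *. set (E := fact (2 * m)) in *.
  set (F := fact k) in *. set (G := fact m) in *. set (H := fact (2 * (k + m))) in *.
  replace (S (k + m) * A * (S (S (2 * k)) * (S (2 * k) * B) * E))%nat
    with (2 * S k * S (k + m) * S (2 * k) * (A * (B * E)))%nat by ring.
  replace (S k * F * G * (S (S (2 * (k + m))) * (S (2 * (k + m)) * H)))%nat
    with (2 * S k * S (k + m) * S (2 * (k + m)) * (F * G * H))%nat by ring.
  apply Nat.mul_le_mono; [apply Nat.mul_le_mono_l; lia | exact IH].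
Qed.

Lemma binomial_fact_double_le (n k : nat) :
  (k <= n)%nat ->
  Binomial.C n k * (INR (fact (2 * (n - k))) * INR (fact (2 * k))) <= INR (fact (2 * n)).
Proof.
  intros hk. unfold Binomial.C.
  assert (h := fact_double_supermul k (n - k)).
  replace (k + (n - k))%nat with n in h by lia.
  apply le_INR in h. rewrite !mult_INR in h.
  assert (h1 := INR_fact_lt_0 k). assert (h2 := INR_fact_lt_0 (n - k)).
  assert (0 < INR (fact k) * INR (fact (n - k))) by now apply Rmult_lt_0_compat.
  apply Rmult_le_reg_l with (INR (fact k) * INR (fact (n - k))); [assumption|].
  eapply Rle_trans; [|exact h]. right. field. lra.
Qed.

Lemma sum_half_pow_le (n : nat) : sum_f_R0 (fun k => (/ 2) ^ k) n <= 2.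
Proof.
  assert (e : sum_f_R0 (fun k => (/ 2) ^ k) n = 2 - (/ 2) ^ n).
  { induction n as [|n IH]; [simpl; lra | rewrite tech5, IH; simpl; lra]. }
  assert (0 < (/ 2) ^ n) by (apply pow_lt; lra). lra.
Qed.

Lemma prod_diff_bound (f g : nat -> R -> R) (M N a b t : R) :
  0 <= M -> 0 <= N -> 0 < a -> 0 <= b -> 2 * b <= a ->
  (forall n, Rabs (f n t) <= M * (a ^ n * INR (fact (2 * n)))) ->
  (forall n, Rabs (g n t) <= N * (b ^ n * INR (fact (2 * n)))) ->
  forall n, Rabs (prod_diff f g n 0 0 t) <= 2 * (M * N) * (a ^ n * INR (fact (2 * n))).
Proof.
  intros hM hN ha hb hab hf hg n. rewrite leibniz.
  eapply Rle_trans; [apply Rsum_abs|].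
  apply Rle_trans with
    (sum_f_R0 (fun k => (/ 2) ^ k * (M * N * (a ^ n * INR (fact (2 * n))))) n).
  2:{ rewrite <- scal_sum, (Rmult_comm _ (sum_f_R0 _ _)).
      assert (h := sum_half_pow_le n).
      assert (0 <= M * N * (a ^ n * INR (fact (2 * n)))).
      { apply Rmult_le_pos; [now apply Rmult_le_pos|].
        apply Rmult_le_pos; [apply pow_le; lra | apply pos_INR]. }
      apply Rle_trans with (2 * (M * N * (a ^ n * INR (fact (2 * n)))));
        [now apply Rmult_le_compat_r | right; ring]. }
  apply sum_Rle. intros k hk. simpl Nat.add.
  assert (hC : 0 <= Binomial.C n k).
  { unfold Binomial.C. apply Rdiv_le_0_compat; [apply pos_INR|].
    apply Rmult_lt_0_compat; apply INR_fact_lt_0. }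
  rewrite !Rabs_mult, (Rabs_pos_eq _ hC).
  apply Rle_trans with (Binomial.C n k * (M * (a ^ (n - k) * INR (fact (2 * (n - k))))
                                          * (N * (b ^ k * INR (fact (2 * k)))))).
  { apply Rmult_le_compat_l; [exact hC|].
    apply Rmult_le_compat; try apply Rabs_pos; [apply hf | apply hg]. }
  assert (hbk : b ^ k <= (/ 2) ^ k * a ^ k).
  { rewrite <- Rpow_mult_distr. apply pow_incr. lra. }
  assert (hpos : 0 <= b ^ k) by now apply pow_le.
  assert (hak : 0 < a ^ (n - k)) by now apply pow_lt.
  assert (hbin := binomial_fact_double_le n k hk).
  assert (hbin0 : 0 <= Binomial.C n k * (INR (fact (2 * (n - k))) * INR (fact (2 * k)))).
  { apply Rmult_le_pos; [exact hC | apply Rmult_le_pos; apply pos_INR]. }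
  assert (ean : a ^ n = a ^ (n - k) * a ^ k) by (rewrite <- pow_add; f_equal; lia).
  rewrite ean.
  replace (Binomial.C n k * (M * (a ^ (n - k) * INR (fact (2 * (n - k))))
             * (N * (b ^ k * INR (fact (2 * k))))))
    with (M * N * (a ^ (n - k) * b ^ k)
          * (Binomial.C n k * (INR (fact (2 * (n - k))) * INR (fact (2 * k))))) by ring.
  replace ((/ 2) ^ k * (M * N * (a ^ (n - k) * a ^ k * INR (fact (2 * n)))))
    with (M * N * (a ^ (n - k) * ((/ 2) ^ k * a ^ k)) * INR (fact (2 * n))) by ring.
  assert (hMN : 0 <= M * N) by now apply Rmult_le_pos.
  apply Rmult_le_compat; auto.
  - repeat apply Rmult_le_pos; lra.
  - apply Rmult_le_compat_l; [exact hMN|]. apply Rmult_le_compat_l; lra.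
Qed.

(** * Cutoff *)

Lemma D_in_of_is_derive (D : R -> Prop) (f df : R -> R) (t : R) :
  is_derive f t (df t) -> D_in f df D t.
Proof.
  intros h. apply (D_in_imp f df no_cond D); [intros; exact I|].
  apply derivable_pt_lim_D_in. now apply is_derive_Reals.
Qed.

Lemma is_derive_of_derivs_on (f : nat -> R -> R) (n : nat) (t : R) :
  derivs_on no_cond f -> is_derive (f n) t (f (S n) t).
Proof. intros h. apply is_derive_Reals, derivable_pt_lim_D_in. now apply h. Qed.

Lemma derivs_on_flat_shift (lam c : R) :
  0 < lam -> derivs_on no_cond (fun n t => flat_exp_diff lam n 0 (t - c)).
Proof.
  intros hl n t _. apply D_in_of_is_derive.
  replace (flat_exp_diff lam (S n) 0 (t - c)) with (1 * flat_exp_diff lam (S n) 0 (t - c)) by ring.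
  apply (is_derive_comp (flat_exp_diff lam n 0) (fun t => t - c)).
  - now apply is_derive_flat_exp_diff.
  - auto_derive; [trivial | ring].
Qed.

Lemma derivs_on_flat_reflect (lam c : R) :
  0 < lam -> derivs_on no_cond (fun n t => (-1) ^ n * flat_exp_diff lam n 0 (c - t)).
Proof.
  intros hl n t _. apply D_in_of_is_derive.
  replace ((-1) ^ S n * flat_exp_diff lam (S n) 0 (c - t))
    with ((-1) ^ n * ((-1) * flat_exp_diff lam (S n) 0 (c - t))) by (simpl; ring).
  apply is_derive_scal.
  apply (is_derive_comp (flat_exp_diff lam n 0) (fun t => c - t)).
  - now apply is_derive_flat_exp_diff.
  - auto_derive; [trivial | ring].
Qed.

(** The choice [lam = 2 / b] turns [(2 / lam)^n] into [b ^ n]. The factor 1 matches the shape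
    expected by [prod_diff_bound]. *)
Lemma flat_exp_diff_gevrey (b : R) (n : nat) (x : R) :
  0 < b -> Rabs (flat_exp_diff (2 / b) n 0 x) <= 1 * (b ^ n * INR (fact (2 * n))).
Proof.
  intros hb. assert (hl : 0 < 2 / b) by (apply Rdiv_lt_0_compat; lra).
  eapply Rle_trans; [now apply flat_exp_diff_bound|].
  right. change (0 + 2 * n)%nat with (2 * n)%nat. change (0 + n)%nat with n.
  unfold Rdiv. rewrite Rpow_mult_distr, pow_inv.
  assert (b ^ n <> 0) by (apply pow_nonzero; lra).
  assert (2 ^ n <> 0) by (apply pow_nonzero; lra).
  field. auto.
Qed.

(** The cutoff is the normalised primitive of a bump that is flat at both endpoints. Taking a
    primitive lowers the order of differentiation by one, so the Gevrey rate of the bump is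
    inherited. *)
Lemma gevrey_cutoff (T1 T2 b : R) :
  T1 < T2 -> 0 < b ->
  exists (chi : nat -> R -> R) (N : R),
    0 <= N /\ derivs_on no_cond chi /\ (forall n, chi n T1 = 0) /\
    chi O T2 = 1 /\ (forall n, chi (S n) T2 = 0) /\
    forall n t, T1 <= t <= T2 -> Rabs (chi n t) <= N * (b ^ n * INR (fact (2 * n))).
Proof.
  intros hT hb.
  set (p := fun n t => flat_exp_diff (2 / b) n 0 (t - T1)).
  (* The second factor has rate [b / 2] so that the product keeps rate [b] by [prod_diff_bound]. *)
  set (q := fun n t => (-1) ^ n * flat_exp_diff (2 / (b / 2)) n 0 (T2 - t)).
  assert (hp : derivs_on no_cond p)
    by (apply derivs_on_flat_shift; apply Rdiv_lt_0_compat; lra).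
  assert (hq : derivs_on no_cond q)
    by (apply derivs_on_flat_reflect; apply Rdiv_lt_0_compat; lra).
  set (psi := fun n => prod_diff p q n 0 0).
  assert (hpsi : derivs_on no_cond psi) by (intros n t ht; now apply D_in_prod_diff).
  assert (bpsi : forall n t, Rabs (psi n t) <= 2 * (b ^ n * INR (fact (2 * n)))).
  { intros n t. replace 2 with (2 * (1 * 1)) at 1 by ring.
    apply prod_diff_bound with (b := b / 2); try lra.
    - intros k. now apply flat_exp_diff_gevrey.
    - intros k. unfold q. rewrite Rabs_mult, pow_1_abs, Rmult_1_l.
      apply flat_exp_diff_gevrey. lra. }
  assert (cpsi : forall t, continuous (psi O) t).
  { intros t. apply (ex_derive_continuous (psi O)). eexists. now apply is_derive_of_derivs_on. }
  assert (ipsi : forall a c, ex_RInt (psi O) a c).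
  { intros a c. apply (ex_RInt_continuous (psi O)). intros; apply cpsi. }
  set (J := RInt (psi O) T1 T2).
  assert (hJ : 0 < J).
  { apply RInt_gt_0; [exact hT | | intros; apply cpsi].
    intros x hx. unfold psi, p, q. simpl. unfold flat_exp.
    destruct (Rlt_dec 0 (x - T1)); [|lra]. destruct (Rlt_dec 0 (T2 - x)); [|lra].
    simpl. rewrite !Rmult_1_l. apply Rmult_lt_0_compat; apply exp_pos. }
  exists (fun n t => match n with O => RInt (psi O) T1 t / J | S n => psi n t / J end).
  (* The first summand bounds the value of the cutoff, the second its derivatives [psi n / J]; its
     [/ b] compensates for having [b ^ n] where the bound at order [n + 1] has [b ^ S n]. *)
  exists (2 * (T2 - T1) / J + 2 / (b * J)).
  assert (hbJ : 0 < b * J) by now apply Rmult_lt_0_compat.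
  assert (c1 : 0 <= 2 * (T2 - T1) / J) by (apply Rdiv_le_0_compat; lra).
  assert (c2 : 0 <= 2 / (b * J)) by (apply Rdiv_le_0_compat; lra).
  split; [lra|]. repeat split.
  - intros n t _. apply D_in_of_is_derive.
    destruct n as [|n]; unfold Rdiv.
    + apply is_derive_ext with (fun t => / J * RInt (psi O) T1 t); [intros; apply Rmult_comm|].
      rewrite Rmult_comm. apply is_derive_scal.
      apply (is_derive_RInt (psi O) _ T1).
      * apply filter_forall. intros x. apply (RInt_correct (psi O)), ipsi.
      * apply cpsi.
    + apply is_derive_ext with (fun t => / J * psi n t); [intros; apply Rmult_comm|].
      rewrite Rmult_comm. apply is_derive_scal. now apply is_derive_of_derivs_on.
  - intros [|n].
    + rewrite RInt_point. unfold zero; simpl. unfold Rdiv. ring.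
    + assert (e : psi n T1 = 0).
      { unfold psi. rewrite leibniz. rewrite <- (sum_eq_R0 (fun _ => 0) n) by auto.
        apply sum_eq. intros k hk. unfold p. rewrite flat_exp_diff_nonpos by lra. ring. }
      rewrite e. unfold Rdiv. ring.
  - unfold J. field. fold J. lra.
  - intros n.
    assert (e : psi n T2 = 0).
    { apply prod_diff_zero_r. intros j. unfold q. rewrite flat_exp_diff_nonpos by lra. ring. }
    rewrite e. unfold Rdiv. ring.
  - intros [|n] t ht.
    + simpl. unfold Rdiv at 1. rewrite Rabs_mult, (Rabs_pos_eq (/ J)).
      2:{ left. now apply Rinv_0_lt_compat. }
      assert (hi : Rabs (RInt (psi O) T1 t) <= (t - T1) * 2).
      { apply abs_RInt_le_const; [lra | apply ipsi |].
        intros x hx. eapply Rle_trans; [apply bpsi|]. simpl. lra. }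
      apply Rle_trans with (2 * (T2 - T1) / J); [|lra].
      apply Rmult_le_compat_r; [left; now apply Rinv_0_lt_compat | lra].
    + unfold Rdiv at 1. rewrite Rabs_mult, (Rabs_pos_eq (/ J)).
      2:{ left. now apply Rinv_0_lt_compat. }
      assert (hbn : 0 < b ^ n) by now apply pow_lt.
      assert (hf : INR (fact (2 * n)) <= INR (fact (2 * S n))) by (apply le_INR, fact_le; lia).
      assert (hf0 := INR_fact_lt_0 (2 * n)).
      apply Rle_trans with (2 / (b * J) * (b ^ S n * INR (fact (2 * S n)))).
      * rewrite <- tech_pow_Rmult.
        replace (2 / (b * J) * (b * b ^ n * INR (fact (2 * S n))))
          with (2 * (b ^ n * INR (fact (2 * S n))) * / J) by (field; lra).
        apply Rmult_le_compat_r; [left; now apply Rinv_0_lt_compat|].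
        eapply Rle_trans; [apply bpsi|].
        apply Rmult_le_compat_l; [lra|]. apply Rmult_le_compat_l; lra.
      * apply Rmult_le_compat_r; [|lra].
        apply Rmult_le_pos; [apply pow_le; lra | apply pos_INR].
Qed.

(** * Laplace integrals *)

Lemma D_in_of_quadratic (D : R -> Prop) (f df : R -> R) (t c : R) :
  0 <= c ->
  (forall x, D x -> Rabs (f x - f t - (x - t) * df t) <= c * (x - t) ^ 2) ->
  D_in f df D t.
Proof.
  intros hc h eps heps.
  exists (eps / (c + 1)). split; [apply Rdiv_lt_0_compat; lra|].
  intros x [[hx hne] hd]. simpl in hd |- *. unfold Rdist in hd |- *.
  assert (hxt : x - t <> 0) by lra.
  assert (hpos : 0 < Rabs (x - t)) by now apply Rabs_pos_lt.
  replace ((f x - f t) / (x - t) - df t) with ((f x - f t - (x - t) * df t) / (x - t))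
    by (field; lra).
  unfold Rdiv. rewrite Rabs_mult, Rabs_inv.
  apply Rle_lt_trans with (c * Rabs (x - t)).
  - apply Rmult_le_reg_r with (Rabs (x - t)); [exact hpos|].
    rewrite Rmult_assoc, Rinv_l, Rmult_1_r by lra.
    eapply Rle_trans; [now apply h|]. right.
    rewrite <- (pow2_abs (x - t)). ring.
  - apply Rle_lt_trans with ((c + 1) * Rabs (x - t)); [nra|].
    apply Rlt_le_trans with ((c + 1) * (eps / (c + 1))).
    + apply Rmult_lt_compat_l; lra.
    + right. field. lra.
Qed.

Definition gamma_weight (k : nat) (s : R) : R := s ^ k * exp (- s).

(** The antiderivative of [s^k e^-s] given by integration by parts. It equals [- k!] at 0 and tends
    to 0 at infinity, which evaluates the Gamma integral. *)
Fixpoint gamma_prim (k : nat) (s : R) : R :=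
  match k with
  | O => - exp (- s)
  | S k' => - gamma_weight k s + INR k * gamma_prim k' s
  end.

Lemma is_derive_gamma_prim (k : nat) (s : R) :
  is_derive (gamma_prim k) s (gamma_weight k s).
Proof.
  induction k as [|k IH].
  - unfold gamma_weight. simpl. auto_derive; [trivial | ring].
  - replace (gamma_weight (S k) s)
      with ((gamma_weight (S k) s - INR (S k) * gamma_weight k s) + INR (S k) * gamma_weight k s)
      by ring.
    apply (@is_derive_plus R_AbsRing R_NormedModule
             (fun s => - gamma_weight (S k) s) (fun s => INR (S k) * gamma_prim k s)).
    + unfold gamma_weight. auto_derive; [trivial|]. change (match k with O => 1 | S _ => INR k + 1 end) with (INR (S k)).
      rewrite <- tech_pow_Rmult. ring.
    + now apply is_derive_scal.
Qed.

Lemma gamma_prim_0 (k : nat) : gamma_prim k 0 = - INR (fact k).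
Proof.
  induction k as [|k IH].
  - simpl. rewrite Ropp_0, exp_0. ring.
  - change (gamma_prim (S k) 0) with (- gamma_weight (S k) 0 + INR (S k) * gamma_prim k 0).
    rewrite IH, fact_simpl, mult_INR. unfold gamma_weight. rewrite pow_i by lia. ring.
Qed.

Lemma gamma_weight_nonneg (k : nat) (s : R) : 0 <= s -> 0 <= gamma_weight k s.
Proof.
  intros hs. apply Rmult_le_pos; [now apply pow_le | left; apply exp_pos].
Qed.

Lemma gamma_prim_nonpos (k : nat) (s : R) : 0 <= s -> gamma_prim k s <= 0.
Proof.
  intros hs. induction k as [|k IH].
  - simpl. assert (h := exp_pos (- s)). lra.
  - change (gamma_prim (S k) s) with (- gamma_weight (S k) s + INR (S k) * gamma_prim k s).
    assert (h := gamma_weight_nonneg (S k) s hs). assert (h' := pos_INR (S k)). nra.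
Qed.

(** One spare power: [s^(k+1) e^-s <= (k+1)!], so the weight is at most [(k+1)! / s]. The sequence
    is shifted to keep [s] positive. *)
Lemma gamma_weight_lim (k : nat) : is_lim_seq (fun n => gamma_weight k (INR n)) 0.
Proof.
  apply is_lim_seq_incr_1.
  apply is_lim_seq_le_le with (fun _ => 0) (fun n => INR (fact (S k)) * / INR (S n)).
  - intros n. assert (hn : 0 < INR (S n)) by (apply lt_0_INR; lia).
    split; [apply gamma_weight_nonneg; lra|].
    assert (h := pow_mul_exp_neg_le 1 (INR (S n)) (S k) Rlt_0_1 (Rlt_le _ _ hn)).
    rewrite pow1, Rmult_1_l, <- tech_pow_Rmult in h. unfold gamma_weight.
    apply Rmult_le_reg_l with (INR (S n)); [exact hn|].
    replace (INR (S n) * (INR (fact (S k)) * / INR (S n))) with (INR (fact (S k)) / 1)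
      by (field; lra).
    rewrite <- Rmult_assoc. exact h.
  - apply is_lim_seq_const.
  - replace (Finite 0) with (Rbar_mult (INR (fact (S k))) 0) by (simpl; f_equal; ring).
    apply is_lim_seq_scal_l.
    apply (is_lim_seq_incr_1 (fun n => / INR n)).
    replace (Finite 0) with (Rbar_inv p_infty) by reflexivity.
    apply is_lim_seq_inv; [apply is_lim_seq_INR | discriminate].
Qed.

Lemma gamma_prim_lim (k : nat) : is_lim_seq (fun n => gamma_prim k (INR n)) 0.
Proof.
  induction k as [|k IH].
  - assert (h := gamma_weight_lim 0).
    apply is_lim_seq_opp in h. simpl in h. rewrite Ropp_0 in h.
    eapply is_lim_seq_ext; [|exact h]. intros n. unfold gamma_weight. simpl. ring.
  - replace 0 with (- 0 + INR (S k) * 0) by ring.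
    apply (is_lim_seq_plus' (fun n => - gamma_weight (S k) (INR n))
             (fun n => INR (S k) * gamma_prim k (INR n))).
    + apply (is_lim_seq_opp (fun n => gamma_weight (S k) (INR n)) 0), gamma_weight_lim.
    + apply (is_lim_seq_scal_l (fun n => gamma_prim k (INR n)) (INR (S k)) 0), IH.
Qed.

Lemma continuous_gamma_weight (k : nat) (s : R) : continuous (gamma_weight k) s.
Proof.
  apply (ex_derive_continuous (gamma_weight k)). unfold gamma_weight. auto_derive. trivial.
Qed.

Lemma RInt_gamma_weight (k : nat) (a b : R) :
  is_RInt (gamma_weight k) a b (gamma_prim k b - gamma_prim k a).
Proof.
  apply (is_RInt_derive (gamma_prim k) (gamma_weight k)).
  - intros x _. apply is_derive_gamma_prim.
  - intros x _. apply continuous_gamma_weight.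
Qed.

(** Continuity is two-sided even at [s = 0]; the Laplace kernels have it because each [u n] is
    differentiable on both sides of 0. *)
Definition cont_nonneg (f : R -> R) : Prop := forall s, 0 <= s -> continuous f s.

Lemma ex_RInt_nonneg (f : R -> R) (a b : R) :
  cont_nonneg f -> 0 <= a -> 0 <= b -> ex_RInt f a b.
Proof.
  intros hf ha hb. apply (ex_RInt_continuous f). intros z hz. apply hf.
  destruct hz as [hz _]. revert hz. unfold Rmin. destruct (Rle_dec a b); lra.
Qed.

Lemma RInt_gamma_le (f : R -> R) (k : nat) (c a b : R) :
  cont_nonneg f -> (forall s, 0 <= s -> Rabs (f s) <= c * gamma_weight k s) ->
  0 <= a <= b -> Rabs (RInt f a b) <= c * (gamma_prim k b - gamma_prim k a).
Proof.
  intros hf hb hab.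
  apply (norm_RInt_le f (fun s => c * gamma_weight k s) a b).
  - lra.
  - intros x hx. apply hb. lra.
  - apply (RInt_correct f). apply ex_RInt_nonneg; auto; lra.
  - apply (is_RInt_scal (gamma_weight k) a b c). apply RInt_gamma_weight.
Qed.

(** The integral over the positive half-line. [Lim_seq] is total, so genuine convergence is supplied
    by [impint_lim] for integrands dominated by a multiple of some [gamma_weight]. *)
Definition impint (f : R -> R) : R := real (Lim_seq (fun n => RInt f 0 (INR n))).

(** Cauchy criterion: increments of the truncated integrals are dominated by those of
    [c * gamma_prim k], which converges. *)
Lemma impint_lim (f : R -> R) (k : nat) (c : R) :
  cont_nonneg f -> 0 <= c -> (forall s, 0 <= s -> Rabs (f s) <= c * gamma_weight k s) ->
  is_lim_seq (fun n => RInt f 0 (INR n)) (impint f).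
Proof.
  intros hf hc hb. apply Lim_seq_correct', ex_lim_seq_cauchy_corr.
  assert (hA : ex_finite_lim_seq (fun n => c * gamma_prim k (INR n))).
  { exists (c * 0). apply (is_lim_seq_scal_l (fun n => gamma_prim k (INR n)) c 0), gamma_prim_lim. }
  apply ex_lim_seq_cauchy_corr in hA.
  assert (key : forall n m, (n <= m)%nat ->
    Rabs (RInt f 0 (INR m) - RInt f 0 (INR n))
    <= Rabs (c * gamma_prim k (INR m) - c * gamma_prim k (INR n))).
  { intros n m hnm. apply le_INR in hnm. assert (hn := pos_INR n).
    assert (ch : RInt f 0 (INR m) = RInt f 0 (INR n) + RInt f (INR n) (INR m)).
    { symmetry. apply (RInt_Chasles f); apply ex_RInt_nonneg; auto; lra. }
    rewrite ch. assert (e : forall x y : R, x + y - x = y) by (intros; ring).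
    rewrite (e (RInt f 0 (INR n)) (RInt f (INR n) (INR m))).
    rewrite <- Rmult_minus_distr_l.
    eapply Rle_trans; [|apply Rle_abs]. apply RInt_gamma_le; auto. }
  intros eps. destruct (hA eps) as [N hN]. exists N. intros n m hn hm.
  destruct (Nat.le_ge_cases n m) as [h|h].
  - rewrite Rabs_minus_sym. eapply Rle_lt_trans; [now apply key|]. now apply hN.
  - eapply Rle_lt_trans; [now apply key|]. now apply hN.
Qed.

Lemma impint_unique (f : R -> R) (l : R) :
  is_lim_seq (fun n => RInt f 0 (INR n)) l -> impint f = l.
Proof. intros h. unfold impint. now rewrite (is_lim_seq_unique _ _ h). Qed.

Lemma impint_bound (f : R -> R) (k : nat) (c : R) :
  cont_nonneg f -> 0 <= c -> (forall s, 0 <= s -> Rabs (f s) <= c * gamma_weight k s) ->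
  Rabs (impint f) <= c * INR (fact k).
Proof.
  intros hf hc hb.
  assert (h := impint_lim f k c hf hc hb).
  apply is_lim_seq_abs in h.
  apply (is_lim_seq_le (fun n => Rabs (RInt f 0 (INR n))) (fun _ => c * INR (fact k))
           (Rabs (impint f)) (c * INR (fact k))); [|exact h | apply is_lim_seq_const].
  intros n. assert (hn := pos_INR n).
  eapply Rle_trans; [apply (RInt_gamma_le f k c); auto; lra|].
  rewrite gamma_prim_0. assert (h' := gamma_prim_nonpos k (INR n) hn).
  apply Rmult_le_compat_l; lra.
Qed.

Lemma impint_gamma (k : nat) (c : R) :
  impint (fun s => c * gamma_weight k s) = c * INR (fact k).
Proof.
  apply impint_unique.
  apply is_lim_seq_ext with (fun n => c * (gamma_prim k (INR n) - gamma_prim k 0)).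
  - intros n. symmetry. apply is_RInt_unique.
    apply (is_RInt_scal (gamma_weight k) 0 (INR n) c), RInt_gamma_weight.
  - rewrite gamma_prim_0.
    apply (is_lim_seq_scal_l _ c (INR (fact k))).
    replace (INR (fact k)) with (0 - - INR (fact k)) at 1 by ring.
    apply is_lim_seq_minus'; [apply gamma_prim_lim | apply is_lim_seq_const].
Qed.

Lemma impint_combination (f g h : R -> R) (k1 k2 k3 : nat) (c1 c2 c3 e : R) :
  cont_nonneg f -> cont_nonneg g -> cont_nonneg h -> 0 <= c1 -> 0 <= c2 -> 0 <= c3 ->
  (forall s, 0 <= s -> Rabs (f s) <= c1 * gamma_weight k1 s) ->
  (forall s, 0 <= s -> Rabs (g s) <= c2 * gamma_weight k2 s) ->
  (forall s, 0 <= s -> Rabs (h s) <= c3 * gamma_weight k3 s) ->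
  impint (fun s => f s - g s - e * h s) = impint f - impint g - e * impint h.
Proof.
  intros cf cg ch p1 p2 p3 bf bg bh. apply impint_unique.
  apply is_lim_seq_ext
    with (fun n => RInt f 0 (INR n) - RInt g 0 (INR n) - e * RInt h 0 (INR n)).
  - intros n. assert (hn := pos_INR n). symmetry. apply is_RInt_unique.
    assert (i : forall q, cont_nonneg q -> is_RInt q 0 (INR n) (RInt q 0 (INR n))).
    { intros q hq. apply (RInt_correct q), ex_RInt_nonneg; auto; lra. }
    apply (is_RInt_minus (fun s => f s - g s) (fun s => e * h s)).
    + apply (is_RInt_minus f g); auto.
    + apply (is_RInt_scal h 0 (INR n) e); auto.
  - apply is_lim_seq_minus'; [apply is_lim_seq_minus'|].
    + now apply (impint_lim f k1 c1).
    + now apply (impint_lim g k2 c2).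
    + apply (is_lim_seq_scal_l _ e (impint h)). now apply (impint_lim h k3 c3).
Qed.

Lemma mean_value_nonpos (f df : R -> R) (c x y : R) :
  (forall z, z <= 0 -> is_derive f z (df z)) ->
  (forall z, Rmin x y <= z <= Rmax x y -> Rabs (df z) <= c) ->
  x <= 0 -> y <= 0 -> Rabs (f y - f x) <= c * Rabs (y - x).
Proof.
  intros hf hb hx hy.
  assert (hle : forall z, Rmin x y <= z <= Rmax x y -> z <= 0).
  { intros z [_ hz]. revert hz. unfold Rmax. destruct (Rle_dec x y); lra. }
  destruct (MVT_gen f x y df) as [z [hz e]].
  - intros z hz. apply hf, hle. lra.
  - intros z hz. apply continuity_pt_filterlim.
    apply (ex_derive_continuous f). exists (df z). apply hf, hle, hz.
  - rewrite e, Rabs_mult. apply Rmult_le_compat_r; [apply Rabs_pos | now apply hb].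
Qed.

(** Two mean value inequalities: one for [z |-> u n z - z * u (S n) x], one for its derivative
    [u (S n) z - u (S n) x]. This gives [c] instead of the sharp [c / 2], which is enough. *)
Lemma taylor1_nonpos (u : nat -> R -> R) (c x y : R) (n : nat) :
  (forall n z, z <= 0 -> is_derive (u n) z (u (S n) z)) ->
  (forall z, z <= 0 -> Rabs (u (S (S n)) z) <= c) ->
  x <= 0 -> y <= 0 ->
  Rabs (u n y - u n x - (y - x) * u (S n) x) <= c * (y - x) ^ 2.
Proof.
  intros hu hb hx hy.
  assert (hle : forall z, Rmin x y <= z <= Rmax x y -> z <= 0 /\ Rabs (z - x) <= Rabs (y - x)).
  { intros z. unfold Rmin, Rmax.
    destruct (Rle_dec x y); intros hz; split; try lra;
      [rewrite !Rabs_pos_eq by lra; lra | rewrite !Rabs_left1 by lra; lra]. }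
  assert (hc : 0 <= c) by (eapply Rle_trans; [apply Rabs_pos | exact (hb x hx)]).
  replace (u n y - u n x - (y - x) * u (S n) x)
    with ((u n y - y * u (S n) x) - (u n x - x * u (S n) x)) by ring.
  eapply Rle_trans.
  - apply (mean_value_nonpos (fun z => u n z - z * u (S n) x) (fun z => u (S n) z - u (S n) x)
             (c * Rabs (y - x))); auto.
    + intros z hz. apply (@is_derive_minus R_AbsRing R_NormedModule (u n)).
      * now apply hu.
      * auto_derive; [trivial | ring].
    + intros z hz. destruct (hle z hz) as [hz0 hzx].
      apply Rle_trans with (c * Rabs (z - x)); [|now apply Rmult_le_compat_l].
      apply (mean_value_nonpos (u (S n)) (u (S (S n)))); auto.
      intros w hw. apply hb. revert hw. unfold Rmin, Rmax. destruct (Rle_dec x z); lra.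
  - right. rewrite <- (pow2_abs (y - x)). ring.
Qed.

(** With [u n = v^(n+1)] this is the derivative of order [n + 1] of the Borel-Laplace sum of [v],
    hence the weight of index [S n]. *)
Definition laplace_diff (u : nat -> R -> R) (n : nat) (t : R) : R :=
  impint (fun s => gamma_weight (S n) s * u n (t * s)).

Section Laplace.
Variables (u : nat -> R -> R) (B : nat -> R).
Hypothesis hu : forall n x, x <= 0 -> is_derive (u n) x (u (S n) x).
Hypothesis hB : forall n x, x <= 0 -> Rabs (u n x) <= B n.

Lemma bound_nonneg (n : nat) : 0 <= B n.
Proof. eapply Rle_trans; [apply Rabs_pos | exact (hB n 0 (Rle_refl 0))]. Qed.

Lemma nonpos_mul (t s : R) : t <= 0 -> 0 <= s -> t * s <= 0.
Proof. nra. Qed.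

Lemma cont_laplace_kernel (n k : nat) (t : R) :
  t <= 0 -> cont_nonneg (fun s => gamma_weight k s * u n (t * s)).
Proof.
  intros ht s hs. apply (continuous_mult (gamma_weight k) (fun s => u n (t * s))).
  - apply continuous_gamma_weight.
  - apply (continuous_comp (fun s => t * s) (u n)).
    + apply (ex_derive_continuous (fun s => t * s)). auto_derive. trivial.
    + apply (ex_derive_continuous (u n)). eexists. now apply hu, nonpos_mul.
Qed.

Lemma laplace_kernel_bound (n k : nat) (t s : R) :
  t <= 0 -> 0 <= s -> Rabs (gamma_weight k s * u n (t * s)) <= B n * gamma_weight k s.
Proof.
  intros ht hs. assert (hg := gamma_weight_nonneg k s hs).
  rewrite Rabs_mult, (Rabs_pos_eq _ hg), Rmult_comm.
  apply Rmult_le_compat_r; [exact hg | now apply hB, nonpos_mul].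
Qed.

Lemma laplace_diff_bound (n : nat) (t : R) :
  t <= 0 -> Rabs (laplace_diff u n t) <= B n * INR (fact (S n)).
Proof.
  intros ht. apply impint_bound.
  - now apply cont_laplace_kernel.
  - apply bound_nonneg.
  - intros s hs. now apply laplace_kernel_bound.
Qed.

Lemma laplace_diff_0 (n : nat) : laplace_diff u n 0 = u n 0 * INR (fact (S n)).
Proof.
  rewrite <- impint_gamma. unfold laplace_diff, impint. f_equal.
  apply Lim_seq_ext. intros k. apply RInt_ext. intros s _.
  rewrite Rmult_0_l. apply Rmult_comm.
Qed.

(** Differentiation under the integral is replaced by integrating the Taylor remainder of [u n]: it
    is at most [B (n+2) s^2 (x - t)^2], and the weight absorbs [s^2]. This also covers the one-sided
    derivative at [t = 0]. *)
Lemma derivs_on_laplace_diff : derivs_on (fun t => t <= 0) (laplace_diff u).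
Proof.
  intros n t ht.
  apply D_in_of_quadratic with (B (S (S n)) * INR (fact (S (S (S n))))).
  { apply Rmult_le_pos; [apply bound_nonneg | apply pos_INR]. }
  intros x hx. unfold laplace_diff.
  rewrite <- (impint_combination _ _ _ (S n) (S n) (S (S n)) (B n) (B n) (B (S n)));
    try apply bound_nonneg; try now apply cont_laplace_kernel.
  2, 3, 4: intros s hs; now apply laplace_kernel_bound.
  replace (B (S (S n)) * INR (fact (S (S (S n)))) * (x - t) ^ 2)
    with (B (S (S n)) * (x - t) ^ 2 * INR (fact (S (S (S n))))) by ring.
  apply impint_bound.
  - intros s hs.
    apply (continuous_minus
      (fun s => gamma_weight (S n) s * u n (x * s) - gamma_weight (S n) s * u n (t * s))
      (fun s => (x - t) * (gamma_weight (S (S n)) s * u (S n) (t * s)))).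
    + apply (continuous_minus (fun s => gamma_weight (S n) s * u n (x * s))
               (fun s => gamma_weight (S n) s * u n (t * s)));
        now apply cont_laplace_kernel.
    + apply (continuous_scal_r (x - t) (fun s => gamma_weight (S (S n)) s * u (S n) (t * s))).
      now apply cont_laplace_kernel.
  - apply Rmult_le_pos; [apply bound_nonneg | apply pow2_ge_0].
  - intros s hs. assert (hg := gamma_weight_nonneg (S n) s hs).
    replace (gamma_weight (S n) s * u n (x * s) - gamma_weight (S n) s * u n (t * s)
             - (x - t) * (gamma_weight (S (S n)) s * u (S n) (t * s)))
      with (gamma_weight (S n) s * (u n (x * s) - u n (t * s) - (x * s - t * s) * u (S n) (t * s)))
      by (unfold gamma_weight; simpl; ring).
    rewrite Rabs_mult, (Rabs_pos_eq _ hg).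
    apply Rle_trans with (gamma_weight (S n) s * (B (S (S n)) * (x * s - t * s) ^ 2)).
    + apply Rmult_le_compat_l; [exact hg|].
      apply taylor1_nonpos; auto; now apply nonpos_mul.
    + right. unfold gamma_weight. simpl. ring.
Qed.

End Laplace.

(** Clamping by [Rmin s 0] extends a function on the half-line to a continuous one on the whole
    line, so that its primitive is differentiable in the two-sided sense even at 0. *)
Lemma continuous_of_D_in_nonpos (f df : R -> R) :
  (forall t, t <= 0 -> D_in f df (fun t => t <= 0) t) ->
  forall t, continuous (fun s => f (Rmin s 0)) t.
Proof.
  intros hf t. apply continuity_pt_filterlim. intros eps heps.
  assert (ht : Rmin t 0 <= 0) by apply Rmin_r.
  destruct (cont_deriv _ _ _ _ (hf _ ht) eps heps) as [del [hdel h]].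
  exists del. split; [exact hdel|]. intros x [_ hd]. simpl in hd |- *.
  destruct (Req_dec (Rmin t 0) (Rmin x 0)) as [e|ne].
  - rewrite e. unfold Rdist. now rewrite Rminus_diag, Rabs_R0.
  - apply h. split; [split; [apply Rmin_r | exact ne]|]. simpl.
    eapply Rle_lt_trans; [|exact hd]. unfold Rdist, Rmin.
    destruct (Rle_dec x 0), (Rle_dec t 0); try lra;
      unfold Rabs; repeat destruct Rcase_abs; lra.
Qed.

(* With [v' = u 0] and [v(0) = c0], this is the Borel-Laplace sum [t |-> int_0^oo e^-s v(ts) ds] and its
   derivatives; the value itself is recovered from the first derivative so that only the
   bounded functions [u n] have to be integrated. *)
Lemma borel_laplace (u : nat -> R -> R) (B : nat -> R) (c0 : R) :
  (forall n x, x <= 0 -> is_derive (u n) x (u (S n) x)) ->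
  (forall n x, x <= 0 -> Rabs (u n x) <= B n) ->
  exists F : nat -> R -> R,
    derivs_on (fun t => t <= 0) F /\
    F O 0 = c0 /\ (forall n, F (S n) 0 = u n 0 * INR (fact (S n))) /\
    (forall t, t <= 0 -> Rabs (F O t) <= Rabs c0 + B O * - t) /\
    (forall n t, t <= 0 -> Rabs (F (S n) t) <= B n * INR (fact (S n))).
Proof.
  intros hu hB. set (L := laplace_diff u).
  assert (hL := derivs_on_laplace_diff u B hu hB). fold L in hL.
  assert (bL : forall n t, t <= 0 -> Rabs (L n t) <= B n * INR (fact (S n)))
    by now apply laplace_diff_bound.
  set (l := fun s => L O (Rmin s 0)).
  assert (hc : forall t, continuous l t) by (apply (continuous_of_D_in_nonpos _ (L 1%nat)); apply hL).
  assert (hi : forall a b, ex_RInt l a b).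
  { intros a b. apply (ex_RInt_continuous l). intros; apply hc. }
  exists (fun n t => match n with O => c0 + RInt l 0 t | S n => L n t end).
  repeat split.
  - intros [|n] t ht; [|now apply hL].
    apply D_in_of_is_derive.
    replace (L O t) with (0 + l t) by (unfold l; rewrite Rmin_left by exact ht; ring).
    apply (@is_derive_plus R_AbsRing R_NormedModule (fun _ => c0) (RInt l 0)).
    + apply (@is_derive_const R_AbsRing R_NormedModule).
    + apply (is_derive_RInt l _ 0).
      * apply filter_forall. intros x. apply (RInt_correct l), hi.
      * apply hc.
  - rewrite RInt_point. apply Rplus_0_r.
  - intros n. apply laplace_diff_0.
  - intros t ht. eapply Rle_trans; [apply Rabs_triang|]. apply Rplus_le_compat_l.
    rewrite <- (opp_RInt_swap l) by apply hi.
    change (opp (RInt l t 0)) with (- RInt l t 0). rewrite Rabs_Ropp.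
    rewrite Rmult_comm. replace (- t) with (0 - t) by ring.
    apply abs_RInt_le_const; [exact ht | apply hi |].
    intros s _. unfold l. eapply Rle_trans; [exact (bL O _ (Rmin_r s 0))|].
    change (INR (fact 1)) with 1. lra.
  - exact bL.
Qed.

(** * The real-valued interpolation problem *)

Lemma D_in_shift (f df : R -> R) (c t : R) (D E : R -> Prop) :
  (forall x, D x -> E (x - c)) ->
  D_in f df E (t - c) -> D_in (fun x => f (x - c)) (fun x => df (x - c)) D t.
Proof.
  intros hDE h.
  apply (D_in_ext (fun x => 1 * df (x - c))); [apply Rmult_1_l|].
  apply (D_in_imp _ _ (Dgf no_cond E (fun x => x - c))).
  - intros x hx. split; [exact I | now apply hDE].
  - apply (Dcomp no_cond E (fun _ => 1) df (fun x => x - c) f); [|exact h].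
    apply D_in_of_is_derive. auto_derive; [trivial | ring].
Qed.

(** This is applied once to real parts and once to imaginary parts, with [a = R^-2]. The products
    [u n x * (n+1)!] appear because [(n+1)!] is the total mass of the Laplace weight of
    [laplace_diff], so the assumed bound passes to the integral with the same [K]. *)
Lemma gevrey_borel_flat (d : nat -> R) (u : nat -> R -> R) (a K T1 T2 : R) :
  0 < a -> 0 <= K -> T1 < T2 ->
  (forall n x, x <= 0 -> is_derive (u n) x (u (S n) x)) ->
  (forall n x, x <= 0 ->
     Rabs (u n x) * INR (fact (S n)) <= K * (a ^ S n * INR (fact (2 * S n)))) ->
  (forall n, u n 0 * INR (fact (S n)) = d (S n)) ->
  exists (f : nat -> R -> R) (M : R),
    derivs_on (fun t => T1 <= t <= T2) f /\
    (forall n, f n T1 = 0) /\ (forall n, f n T2 = d n) /\ 0 <= M /\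
    forall n t, T1 <= t <= T2 -> Rabs (f n t) <= M * (a ^ n * INR (fact (2 * n))).
Proof.
  intros ha hK hT hu hb hd.
  set (B := fun n => K * (a ^ S n * INR (fact (2 * S n))) / INR (fact (S n))).
  assert (hB : forall n x, x <= 0 -> Rabs (u n x) <= B n).
  { intros n x hx. assert (hf := INR_fact_lt_0 (S n)).
    apply Rmult_le_reg_r with (INR (fact (S n))); [exact hf|].
    unfold B, Rdiv. rewrite (Rmult_assoc _ (/ _)), Rinv_l, Rmult_1_r by lra. now apply hb. }
  destruct (borel_laplace u B (d O) hu hB) as [F [hF [F0 [FS [bF0 bFS]]]]].
  (* [a / 2] is the largest cutoff rate that [prod_diff_bound] admits against [a]. *)
  destruct (gevrey_cutoff T1 T2 (a / 2) hT ltac:(lra))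
    as [chi [N [hN [hchi [chi1 [chi2 [chi2S bchi]]]]]]].
  set (G := fun n t => F n (t - T2)).
  (* The first two summands bound the value, which grows at most linearly over the length of the
     interval; [K] bounds every derivative. *)
  set (M := Rabs (d O) + B O * (T2 - T1) + K).
  assert (hB0 : 0 <= B O) by (apply (bound_nonneg u); exact hB).
  assert (hM : Rabs (d O) + B O * (T2 - T1) <= M) by (unfold M; lra).
  assert (hM0 : 0 <= Rabs (d O) + B O * (T2 - T1)).
  { apply Rplus_le_le_0_compat; [apply Rabs_pos|]. apply Rmult_le_pos; lra. }
  assert (bG : forall n t, T1 <= t <= T2 -> Rabs (G n t) <= M * (a ^ n * INR (fact (2 * n)))).
  { intros [|n] t ht; unfold G.
    - simpl. rewrite !Rmult_1_r. eapply Rle_trans; [apply bF0; lra|].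
      eapply Rle_trans; [|exact hM]. apply Rplus_le_compat_l, Rmult_le_compat_l; lra.
    - eapply Rle_trans; [apply bFS; lra|]. unfold B, Rdiv.
      rewrite Rmult_assoc, Rinv_l, Rmult_1_r by apply INR_fact_neq_0.
      apply Rmult_le_compat_r; [|unfold M; lra].
      apply Rmult_le_pos; [apply pow_le; lra | apply pos_INR]. }
  exists (fun n => prod_diff G chi n 0 0), (2 * (M * N)).
  repeat split.
  - intros n t ht. apply D_in_prod_diff; [| |exact ht].
    + intros k x hx. apply (D_in_shift _ _ _ _ _ (fun x => x <= 0)); [intros; lra|].
      apply hF. lra.
    + intros k x hx. apply (D_in_imp _ _ no_cond); [intros; exact I | now apply hchi].
  - intros n. now apply prod_diff_zero_r.
  - intros n. rewrite prod_diff_flat_r by assumption. unfold G. rewrite Rminus_diag. simpl.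
    destruct n as [|n]; [exact F0 | now rewrite FS].
  - apply Rmult_le_pos; [lra|]. apply Rmult_le_pos; [lra | exact hN].
  - intros n t ht. apply prod_diff_bound with (b := a / 2); try lra.
    + intros k. now apply bG.
    + intros k. now apply bchi.
Qed.

(** * Complex power series *)

Definition psum (a : nat -> C) (z : C) (n : nat) : C :=
  @sum_n C_AbelianMonoid (fun k => Cmult (@pow_n C_Ring z k) (a k)) n.

Definition has_sum (a : nat -> C) (z l : C) : Prop :=
  forall eps, 0 < eps -> exists N, forall n, (N <= n)%nat -> Cmod (psum a z n - l) < eps.

Lemma has_sum_of_is_pseries (a : nat -> C) (z l : C) :
  @is_pseries C_AbsRing C_NormedModule a z l -> has_sum a z l.
Proof.
  intros h eps heps.
  assert (h' := proj1 (@filterlim_locally_ball_norm C_AbsRing nat C_NormedModule eventually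
    _ (psum a z) l) h (mkposreal eps heps)).
  destruct h' as [N hN]. exists N. intros n hn. exact (hN n hn).
Qed.

Lemma psum_S (a : nat -> C) (z : C) (n : nat) :
  psum a z (S n) = (psum a z n + @pow_n C_Ring z (S n) * a (S n))%C.
Proof. unfold psum. now rewrite sum_Sn. Qed.

Lemma psum_0 (a : nat -> C) (z : C) : psum a z 0 = a O.
Proof. unfold psum. rewrite sum_O. apply Cmult_1_l. Qed.

Lemma Cmod_pow_n (z : C) (k : nat) : Cmod (@pow_n C_Ring z k) = Cmod z ^ k.
Proof.
  induction k as [|k IH]; [apply Cmod_1|].
  change (@pow_n C_Ring z (S k)) with (Cmult z (@pow_n C_Ring z k)).
  rewrite Cmod_mult, IH. reflexivity.
Qed.

Lemma has_sum_at_0 (a : nat -> C) (l : C) : has_sum a 0 l -> l = a O.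
Proof.
  intros h.
  assert (e : forall n, psum a 0 n = a O).
  { induction n as [|n IH]; [apply psum_0|]. rewrite psum_S, IH.
    change (@pow_n C_Ring (RtoC 0) (S n)) with (Cmult 0 (@pow_n C_Ring (RtoC 0) n)). ring. }
  assert (hz : Cmod (a O - l) = 0).
  { destruct (Cmod_ge_0 (a O - l)) as [hp|hp]; [|now symmetry].
    destruct (h _ hp) as [N hN]. specialize (hN N (Nat.le_refl N)). rewrite e in hN. lra. }
  apply Cmod_eq_0 in hz. symmetry. rewrite <- (Cplus_0_l l), <- hz. ring.
Qed.

Lemma seq_initial_bound (f : nat -> R) (N : nat) : exists B, forall k, (k <= N)%nat -> f k <= B.
Proof.
  induction N as [|N [B hB]].
  - exists (f O). intros k hk. replace k with O by lia. apply Rle_refl.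
  - exists (Rmax B (f (S N))). intros k hk. destruct (Nat.eq_dec k (S N)) as [->|ne].
    + apply Rmax_r.
    + eapply Rle_trans; [apply hB; lia | apply Rmax_l].
Qed.

Lemma has_sum_terms_bounded (a : nat -> C) (z l : C) :
  has_sum a z l -> exists B, 0 <= B /\ forall k, Cmod (a k) * Cmod z ^ k <= B.
Proof.
  intros h. destruct (h 1 Rlt_0_1) as [N hN].
  destruct (seq_initial_bound (fun k => Cmod (a k) * Cmod z ^ k) N) as [B hB].
  (* Beyond [N] a term is the difference of two partial sums, each within 1 of the limit; hence the
     2. *)
  exists (Rmax B 2). split; [eapply Rle_trans; [|apply Rmax_r]; lra|].
  intros k. destruct (Nat.le_gt_cases k N) as [hk|hk].
  - eapply Rle_trans; [now apply hB | apply Rmax_l].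
  - eapply Rle_trans; [|apply Rmax_r]. destruct k as [|k]; [lia|].
    rewrite <- Cmod_pow_n, Rmult_comm, <- Cmod_mult.
    replace (@pow_n C_Ring z (S k) * a (S k))%C
      with ((psum a z (S k) - l) + - (psum a z k - l))%C by (rewrite psum_S; ring).
    eapply Rle_trans; [apply Cmod_triangle|]. rewrite Cmod_opp.
    assert (h1 := hN (S k) ltac:(lia)). assert (h2 := hN k ltac:(lia)). lra.
Qed.

Definition dcoef (a : nat -> C) (n : nat) : C := (RtoC (INR (S n)) * a (S n))%C.

Lemma INR_S_le_pow2 (k : nat) : INR (S k) <= 2 ^ k.
Proof.
  induction k as [|k IH]; [simpl; lra|]. rewrite S_INR. simpl (2 ^ S k).
  assert (1 <= 2 ^ k) by (apply pow_R1_Rle; lra). lra.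
Qed.

(* The radius [8 * r] leaves room for the polynomial factors of the first two derivatives:
   [(k+1)^2 <= 4^(k+1)], so the terms still decay like [2^-k]. *)
Lemma has_sum_dcoef_ex (a : nat -> C) (z : C) (B r : R) :
  0 < r -> (forall k, Cmod (a k) * (8 * r) ^ k <= B) -> Cmod z <= r ->
  exists l, has_sum (dcoef a) z l.
Proof.
  intros hr hB hz.
  assert (h : @ex_series C_AbsRing C_NormedModule
                (fun k => @scal C_AbsRing C_NormedModule (@pow_n C_AbsRing z k) (dcoef a k))).
  { apply (@ex_series_le C_AbsRing C_CompleteNormedModule _ (fun k => (/ 2) ^ k * (B / (8 * r)))).
    2:{ apply ex_series_scal_r, ex_series_geom. rewrite Rabs_pos_eq; lra. }
    intros k.
    change (Cmod (Cmult (@pow_n C_Ring z k) (dcoef a k)) <= (/ 2) ^ k * (B / (8 * r))).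
    unfold dcoef. rewrite !Cmod_mult, Cmod_pow_n, Cmod_R, Rabs_pos_eq by apply pos_INR.
    assert (h1 : Cmod z ^ k <= r ^ k) by (apply pow_incr; split; [apply Cmod_ge_0 | exact hz]).
    assert (h2 := INR_S_le_pow2 k).
    assert (h3 := hB (S k)).
    assert (hrk : 0 < r ^ k) by now apply pow_lt.
    assert (p8 : 0 < 8 ^ k) by (apply pow_lt; lra).
    assert (p2 : 0 < 2 ^ k) by (apply pow_lt; lra).
    assert (p24 : 4 ^ k * 2 ^ k = 8 ^ k) by (rewrite <- Rpow_mult_distr; f_equal; lra).
    assert (e4 : 4 ^ k = 2 ^ k * 2 ^ k) by (rewrite <- Rpow_mult_distr; f_equal; lra).
    assert (hA := Cmod_ge_0 (a (S k))).
    apply Rle_trans with (r ^ k * (2 ^ k * Cmod (a (S k)))).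
    { apply Rmult_le_compat; auto using pow_le, Cmod_ge_0.
      - apply Rmult_le_pos; [apply pos_INR | exact hA].
      - now apply Rmult_le_compat_r. }
    rewrite Rpow_mult_distr in h3. simpl in h3.
    rewrite pow_inv.
    apply Rmult_le_reg_r with (2 ^ k * (8 * r)); [apply Rmult_lt_0_compat; lra|].
    replace (/ 2 ^ k * (B / (8 * r)) * (2 ^ k * (8 * r))) with B by (field; lra).
    eapply Rle_trans; [|exact h3].
    rewrite <- p24, e4.
    set (A := Cmod (a (S k))) in *. set (P := 2 ^ k) in *. set (Q := r ^ k) in *.
    replace (Q * (P * A) * (P * (8 * r))) with (A * (8 * r * Q) * (P * P) * 1) by ring.
    replace (A * (8 * (P * P * P) * (r * Q))) with (A * (8 * r * Q) * (P * P) * P) by ring.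
    apply Rmult_le_compat_l; [|unfold P; apply pow_R1_Rle; lra].
    repeat apply Rmult_le_pos; lra. }
  destruct h as [l hl]. exists l. now apply has_sum_of_is_pseries.
Qed.

(** The natural bound has [r^(k-1)]; the factor [r ^ 2] on the left avoids that exponent at [k = 0].
    The remainders satisfy [e' = w e + (k+1) (w - z)^2 z^k], and with [m = k + 1] the induction
    closes by [m^2 + m <= (m+1)^2]. *)
Lemma pow_taylor_bound (z w : C) (r : R) (k : nat) :
  0 <= r -> Cmod z <= r -> Cmod w <= r ->
  r ^ 2 * Cmod (@pow_n C_Ring w (S k) - @pow_n C_Ring z (S k)
                - (w - z) * (RtoC (INR (S k)) * @pow_n C_Ring z k))
  <= INR (S k) ^ 2 * r ^ S k * Cmod (w - z) ^ 2.
Proof.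
  intros hr hz hw. induction k as [|k IH].
  - assert (e : (@pow_n C_Ring w 1 - @pow_n C_Ring z 1 - (w - z) * (RtoC (INR 1) * @pow_n C_Ring z 0)
                 = 0)%C).
    { change (w * 1 - z * 1 - (w - z) * (1 * 1) = 0)%C. ring. }
    rewrite e, Cmod_0, Rmult_0_r.
    apply Rmult_le_pos; [apply Rmult_le_pos|]; try apply pow2_ge_0. now apply pow_le.
  - set (e := (@pow_n C_Ring w (S k) - @pow_n C_Ring z (S k)
                - (w - z) * (RtoC (INR (S k)) * @pow_n C_Ring z k))%C) in *.
    assert (E : (@pow_n C_Ring w (S (S k)) - @pow_n C_Ring z (S (S k))
                - (w - z) * (RtoC (INR (S (S k))) * @pow_n C_Ring z (S k))
                = w * e + RtoC (INR (S k)) * ((w - z) * (w - z)) * @pow_n C_Ring z k)%C).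
    { unfold e. rewrite (S_INR (S k)), RtoC_plus.
      change (@pow_n C_Ring w (S (S k))) with (w * @pow_n C_Ring w (S k))%C.
      change (@pow_n C_Ring z (S (S k))) with (z * (z * @pow_n C_Ring z k))%C.
      change (@pow_n C_Ring z (S k)) with (z * @pow_n C_Ring z k)%C. ring. }
    rewrite E.
    apply Rle_trans with (r ^ 2 * (Cmod w * Cmod e
      + INR (S k) * (Cmod (w - z) * Cmod (w - z)) * Cmod z ^ k)).
    { apply Rmult_le_compat_l; [apply pow2_ge_0|].
      eapply Rle_trans; [apply Cmod_triangle|].
      rewrite !Cmod_mult, Cmod_pow_n, Cmod_R, (Rabs_pos_eq _ (pos_INR (S k))). apply Rle_refl. }
    assert (hk := pos_INR (S k)). assert (he := Cmod_ge_0 e).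
    assert (hzk : Cmod z ^ k <= r ^ k) by (apply pow_incr; split; [apply Cmod_ge_0 | exact hz]).
    assert (hrk : 0 <= r ^ k) by now apply pow_le.
    assert (hh : 0 <= Cmod (w - z) ^ 2) by apply pow2_ge_0.
    apply Rle_trans with (r * (r ^ 2 * Cmod e) + INR (S k) * r ^ 2 * r ^ k * Cmod (w - z) ^ 2).
    { replace (r ^ 2 * (Cmod w * Cmod e + INR (S k) * (Cmod (w - z) * Cmod (w - z)) * Cmod z ^ k))
        with (Cmod w * (r ^ 2 * Cmod e) + INR (S k) * r ^ 2 * Cmod (w - z) ^ 2 * Cmod z ^ k) by ring.
      replace (INR (S k) * r ^ 2 * r ^ k * Cmod (w - z) ^ 2)
        with (INR (S k) * r ^ 2 * Cmod (w - z) ^ 2 * r ^ k) by ring.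
      apply Rplus_le_compat.
      - apply Rmult_le_compat_r; [|exact hw]. apply Rmult_le_pos; [apply pow2_ge_0 | exact he].
      - apply Rmult_le_compat_l; [|exact hzk].
        apply Rmult_le_pos; [|exact hh]. apply Rmult_le_pos; [exact hk | apply pow2_ge_0]. }
    apply Rle_trans with (r * (INR (S k) ^ 2 * r ^ S k * Cmod (w - z) ^ 2)
                          + INR (S k) * r ^ 2 * r ^ k * Cmod (w - z) ^ 2).
    { apply Rplus_le_compat_r, Rmult_le_compat_l; assumption. }
    rewrite (S_INR (S k)). set (m := INR (S k)) in *.
    replace (r * (m ^ 2 * r ^ S k * Cmod (w - z) ^ 2) + m * r ^ 2 * r ^ k * Cmod (w - z) ^ 2)
      with ((m ^ 2 + m) * (r ^ 2 * r ^ k * Cmod (w - z) ^ 2)) by (simpl; ring).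
    replace ((m + 1) ^ 2 * r ^ S (S k) * Cmod (w - z) ^ 2)
      with ((m + 1) ^ 2 * (r ^ 2 * r ^ k * Cmod (w - z) ^ 2)) by (simpl; ring).
    apply Rmult_le_compat_r; [|nra].
    apply Rmult_le_pos; [apply Rmult_le_pos; [apply pow2_ge_0 | exact hrk] | exact hh].
Qed.

(** The factor [8^(k+1)] supplied by the coefficient bound splits as [4^(k+1) * 2^(k+1)]: the first
    part absorbs [(k+1)^2], the second makes the terms decay geometrically. The factor
    [1 - (/ 2) ^ S n] is the exact partial geometric sum, which lets the induction close. *)
Lemma psum_taylor_bound (a : nat -> C) (z w : C) (B r : R) (n : nat) :
  0 < r -> (forall k, Cmod (a k) * (8 * r) ^ k <= B) -> Cmod z <= r -> Cmod w <= r ->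
  Cmod (psum a w (S n) - psum a z (S n) - (w - z) * psum (dcoef a) z n)
  <= B / r ^ 2 * (1 - (/ 2) ^ S n) * Cmod (w - z) ^ 2.
Proof.
  intros hr hB hz hw.
  assert (hh : 0 <= Cmod (w - z) ^ 2) by apply pow2_ge_0.
  assert (hr2 : 0 < r ^ 2) by now apply pow_lt.
  assert (term : forall k,
    Cmod ((@pow_n C_Ring w (S k) - @pow_n C_Ring z (S k)
           - (w - z) * (RtoC (INR (S k)) * @pow_n C_Ring z k)) * a (S k))
    <= B / r ^ 2 * (/ 2) ^ S k * Cmod (w - z) ^ 2).
  { intros k. rewrite Cmod_mult.
    assert (h := pow_taylor_bound z w r k (Rlt_le _ _ hr) hz hw).
    set (e := Cmod (@pow_n C_Ring w (S k) - _ - _)) in *.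
    assert (hA := Cmod_ge_0 (a (S k))). set (A := Cmod (a (S k))) in *.
    assert (h3 := hB (S k)). fold A in h3. rewrite Rpow_mult_distr in h3.
    assert (hm : INR (S k) ^ 2 <= 4 ^ S k).
    { replace (4 ^ S k) with ((2 ^ S k) ^ 2)
        by (rewrite <- !pow_mult, Nat.mul_comm, pow_mult; f_equal; lra).
      apply pow_incr. split; [apply pos_INR|].
      eapply Rle_trans; [apply INR_S_le_pow2|]. apply Rle_pow; [lra | lia]. }
    assert (p2 : 0 < 2 ^ S k) by (apply pow_lt; lra).
    assert (p48 : 4 ^ S k * 2 ^ S k = 8 ^ S k) by (rewrite <- Rpow_mult_distr; f_equal; lra).
    assert (hrk : 0 < r ^ S k) by now apply pow_lt.
    rewrite pow_inv.
    apply Rmult_le_reg_r with (r ^ 2 * 2 ^ S k); [now apply Rmult_lt_0_compat|].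
    replace (B / r ^ 2 * / 2 ^ S k * Cmod (w - z) ^ 2 * (r ^ 2 * 2 ^ S k))
      with (B * Cmod (w - z) ^ 2) by (field; split; lra).
    replace (e * A * (r ^ 2 * 2 ^ S k)) with (r ^ 2 * e * (A * 2 ^ S k)) by ring.
    apply Rle_trans with (INR (S k) ^ 2 * r ^ S k * Cmod (w - z) ^ 2 * (A * 2 ^ S k)).
    { apply Rmult_le_compat_r; [|exact h]. apply Rmult_le_pos; lra. }
    apply Rle_trans with (4 ^ S k * r ^ S k * Cmod (w - z) ^ 2 * (A * 2 ^ S k)).
    { apply Rmult_le_compat_r; [apply Rmult_le_pos; lra|].
      apply Rmult_le_compat_r; [exact hh|]. apply Rmult_le_compat_r; lra. }
    replace (4 ^ S k * r ^ S k * Cmod (w - z) ^ 2 * (A * 2 ^ S k))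
      with (A * ((4 ^ S k * 2 ^ S k) * r ^ S k) * Cmod (w - z) ^ 2) by ring.
    rewrite p48. now apply Rmult_le_compat_r. }
  induction n as [|n IH].
  - replace (psum a w 1 - psum a z 1 - (w - z) * psum (dcoef a) z 0)%C
      with ((@pow_n C_Ring w 1 - @pow_n C_Ring z 1
           - (w - z) * (RtoC (INR 1) * @pow_n C_Ring z 0)) * a 1%nat)%C.
    + eapply Rle_trans; [apply term|]. right. simpl. field. lra.
    + rewrite !psum_S, !psum_0. unfold dcoef. change (@pow_n C_Ring z 0) with (RtoC 1). ring.
  - rewrite (psum_S a w (S n)), (psum_S a z (S n)), (psum_S (dcoef a) z n).
    replace (psum a w (S n) + @pow_n C_Ring w (S (S n)) * a (S (S n))
             - (psum a z (S n) + @pow_n C_Ring z (S (S n)) * a (S (S n)))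
             - (w - z) * (psum (dcoef a) z n + @pow_n C_Ring z (S n) * dcoef a (S n)))%C
      with ((psum a w (S n) - psum a z (S n) - (w - z) * psum (dcoef a) z n)
            + (@pow_n C_Ring w (S (S n)) - @pow_n C_Ring z (S (S n))
               - (w - z) * (RtoC (INR (S (S n))) * @pow_n C_Ring z (S n))) * a (S (S n)))%C
      by (unfold dcoef; ring).
    eapply Rle_trans; [apply Cmod_triangle|].
    eapply Rle_trans; [apply Rplus_le_compat; [exact IH | apply term]|].
    right. simpl. field. lra.
Qed.

Lemma has_sum_taylor_bound (a : nat -> C) (z w : C) (B r : R) (lz lw l : C) :
  0 < r -> (forall k, Cmod (a k) * (8 * r) ^ k <= B) -> Cmod z <= r -> Cmod w <= r ->
  has_sum a z lz -> has_sum a w lw -> has_sum (dcoef a) z l ->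
  Cmod (lw - lz - (w - z) * l) <= B / r ^ 2 * Cmod (w - z) ^ 2.
Proof.
  intros hr hB hz hw sz sw sl. apply Rle_plus_epsilon. intros eps heps.
  assert (hm := Cmod_ge_0 (w - z)).
  (* The three truncation errors add up to at most [e * (2 + Cmod (w - z)) = eps]. *)
  set (e := eps / (2 + Cmod (w - z))).
  assert (he : 0 < e) by (apply Rdiv_lt_0_compat; lra).
  destruct (sz e he) as [N1 h1]. destruct (sw e he) as [N2 h2]. destruct (sl e he) as [N3 h3].
  set (n := (N1 + N2 + N3)%nat).
  specialize (h1 (S n) ltac:(lia)). specialize (h2 (S n) ltac:(lia)). specialize (h3 n ltac:(lia)).
  replace (lw - lz - (w - z) * l)%C
    with ((psum a w (S n) - psum a z (S n) - (w - z) * psum (dcoef a) z n)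
          + (- (psum a w (S n) - lw) + ((psum a z (S n) - lz) + (w - z) * (psum (dcoef a) z n - l))))%C
    by ring.
  eapply Rle_trans; [apply Cmod_triangle|]. apply Rplus_le_compat.
  - eapply Rle_trans; [now apply psum_taylor_bound with (B := B) (r := r)|].
    assert (0 < (/ 2) ^ S n) by (apply pow_lt; lra).
    assert (hB0 : 0 <= B).
    { eapply Rle_trans; [|exact (hB O)]. rewrite pow_O, Rmult_1_r. apply Cmod_ge_0. }
    assert (hc : 0 <= B / r ^ 2) by (apply Rdiv_le_0_compat; [exact hB0 | now apply pow_lt]).
    apply Rmult_le_compat_r; [apply pow2_ge_0|].
    rewrite <- (Rmult_1_r (B / r ^ 2)) at 2. apply Rmult_le_compat_l; lra.
  - eapply Rle_trans; [apply Cmod_triangle|].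
    eapply Rle_trans; [apply Rplus_le_compat_l, Cmod_triangle|].
    rewrite Cmod_opp, Cmod_mult.
    assert (Cmod (w - z) * Cmod (psum (dcoef a) z n - l) <= Cmod (w - z) * e)
      by (apply Rmult_le_compat_l; lra).
    apply Rle_trans with (e + (e + Cmod (w - z) * e)); [lra|].
    right. unfold e. field. lra.
Qed.

(** * Local power series and iterated complex derivatives *)

Definition series_at (G : C -> C) (z0 : C) (a : nat -> C) : Prop :=
  exists r, 0 < r /\ forall z, Cmod (z - z0) < r -> has_sum a (z - z0) (G z).

Lemma locally_C_Cmod (z0 : C) (P : C -> Prop) :
  locally z0 P -> exists r, 0 < r /\ forall z, Cmod (z - z0) < r -> P z.
Proof.
  intros [eps h]. exists eps. split; [apply cond_pos|].
  intros z hz. apply h. now apply C_NormedModule_mixin_compat1.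
Qed.

Lemma series_at_of_locally (G : C -> C) (z0 : C) (a : nat -> C) :
  locally z0 (fun z => @is_pseries C_AbsRing C_NormedModule a (z - z0)%C (G z)) ->
  series_at G z0 a.
Proof.
  intros h. destruct (locally_C_Cmod _ _ h) as [r [hr hP]].
  exists r. split; [exact hr|]. intros z hz. now apply has_sum_of_is_pseries, hP.
Qed.

(** Complex differentiability with a quadratic remainder, which is what the power series estimate
    provides and which passes directly to real and imaginary parts. *)
Definition C_diff (G : C -> C) (z l : C) : Prop :=
  exists c r, 0 < r /\ 0 <= c /\ forall w, Cmod (w - z) < r ->
    Cmod (G w - G z - (w - z) * l) <= c * Cmod (w - z) ^ 2.

Lemma C_diff_derive (G : C -> C) (z l : C) : C_diff G z l -> C_derive G z = l.
Proof.
  intros [c [r [hr [hc h]]]]. apply is_C_derive_unique. split.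
  - apply (@is_linear_scal_l C_AbsRing C_NormedModule).
  - intros x hx. apply (@is_filter_lim_locally_unique C_AbsRing (AbsRing_NormedModule C_AbsRing)) in hx. subst x.
    intros eps.
    assert (he : 0 < Rmin r (eps / (c + 1))).
    { apply Rmin_glb_lt; [exact hr|]. apply Rdiv_lt_0_compat; [apply cond_pos | lra]. }
    exists (mkposreal _ he). intros w hw.
    change (Cmod (w - z) < Rmin r (eps / (c + 1))) in hw.
    change (Cmod (G w - G z - (w - z) * l) <= eps * Cmod (w - z)).
    assert (h1 := Rmin_l r (eps / (c + 1))). assert (h2 := Rmin_r r (eps / (c + 1))).
    eapply Rle_trans; [apply h; lra|].
    assert (hm := Cmod_ge_0 (w - z)).
    replace (c * Cmod (w - z) ^ 2) with (c * Cmod (w - z) * Cmod (w - z)) by ring.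
    apply Rmult_le_compat_r; [exact hm|].
    apply Rle_trans with ((c + 1) * (eps / (c + 1))); [|right; field; lra].
    apply Rmult_le_compat; lra.
Qed.

(** Differentiability is proved at every point of a smaller disc, not only at [z0], so the
    conclusion is again a [series_at] and can be iterated. *)
Lemma series_at_derive (G : C -> C) (z0 : C) (a : nat -> C) :
  series_at G z0 a ->
  series_at (C_derive G) z0 (dcoef a) /\ C_diff G z0 (C_derive G z0).
Proof.
  intros [s [hs h]].
  (* Convergence at a point of modulus [s / 2] bounds the terms there; the choice [r = s / 16] below
     makes this radius equal to [8 * r]. *)
  set (rho := RtoC (s / 2)).
  assert (hrho : Cmod rho = s / 2) by (unfold rho; rewrite Cmod_R, Rabs_pos_eq; lra).
  destruct (has_sum_terms_bounded a rho (G (z0 + rho)%C)) as [B [hB0 hB]].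
  { replace rho with (z0 + rho - z0)%C at 1 by ring. apply h.
    replace (z0 + rho - z0)%C with rho by ring. lra. }
  set (r := s / 16).
  assert (hr : 0 < r) by (unfold r; lra).
  assert (hB' : forall k, Cmod (a k) * (8 * r) ^ k <= B).
  { intros k. replace (8 * r) with (Cmod rho) by (rewrite hrho; unfold r; lra). apply hB. }
  assert (key : forall z, Cmod (z - z0) < r -> exists l, has_sum (dcoef a) (z - z0) l /\ C_diff G z l).
  { intros z hz. destruct (has_sum_dcoef_ex a (z - z0) B r hr hB' (Rlt_le _ _ hz)) as [l hl].
    exists l. split; [exact hl|].
    exists (B / r ^ 2), (r - Cmod (z - z0)). split; [lra|].
    split; [apply Rdiv_le_0_compat; [exact hB0 | now apply pow_lt]|].
    intros w hw.
    assert (hw0 : Cmod (w - z0) < r).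
    { replace (w - z0)%C with ((w - z) + (z - z0))%C by ring.
      eapply Rle_lt_trans; [apply Cmod_triangle|]. lra. }
    replace (w - z)%C with ((w - z0) - (z - z0))%C by ring.
    apply has_sum_taylor_bound with (a := a); auto; try lra.
    - apply h. unfold r in *. lra.
    - apply h. unfold r in *. lra. }
  assert (hz0 : Cmod (z0 - z0) < r).
  { replace (z0 - z0)%C with (RtoC 0) by ring. rewrite Cmod_0. exact hr. }
  split.
  - exists r. split; [exact hr|]. intros z hz. destruct (key z hz) as [l [hl hd]].
    now rewrite (C_diff_derive G z l hd).
  - destruct (key z0 hz0) as [l [_ hd]]. now rewrite (C_diff_derive G z0 l hd).
Qed.

Lemma series_at_derive_n (G : C -> C) (z0 : C) (a : nat -> C) (n : nat) :
  series_at G z0 a -> series_at (C_derive_n G n) z0 (Nat.iter n dcoef a).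
Proof.
  intros h. induction n as [|n IH]; [exact h|]. now apply series_at_derive.
Qed.

(** Factorials stand on both sides to avoid the quotient [(k+n)! / k!]; the case [k = 0] gives the
    derivatives at the centre. *)
Lemma iter_dcoef (a : nat -> C) (n k : nat) :
  (RtoC (INR (fact k)) * Nat.iter n dcoef a k = RtoC (INR (fact (k + n))) * a (k + n)%nat)%C.
Proof.
  revert k. induction n as [|n IH]; intros k.
  - now rewrite Nat.add_0_r.
  - change (Nat.iter (S n) dcoef a k) with (RtoC (INR (S k)) * Nat.iter n dcoef a (S k))%C.
    rewrite Cmult_assoc, <- RtoC_mult, (Rmult_comm (INR (fact k))), <- mult_INR.
    change (S k * fact k)%nat with (fact (S k)). rewrite IH.
    now replace (S k + n)%nat with (k + S n)%nat by lia.
Qed.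

Lemma C_derive_n_at_0 (G : C -> C) (a : nat -> C) (n : nat) :
  series_at G 0 a -> C_derive_n G n 0 = (RtoC (INR (fact n)) * a n)%C.
Proof.
  intros h. destruct (series_at_derive_n _ _ _ n h) as [r [hr hs]].
  assert (e : C_derive_n G n 0 = Nat.iter n dcoef a O).
  { apply has_sum_at_0. replace (RtoC 0) with (RtoC 0 - RtoC 0)%C at 1 by ring.
    apply hs. replace (RtoC 0 - RtoC 0)%C with (RtoC 0) by ring. now rewrite Cmod_0. }
  assert (e' := iter_dcoef a n 0). simpl (0 + n)%nat in e'. rewrite <- e', e.
  change (INR (fact 0)) with 1. ring.
Qed.

(** * Real and imaginary parts along the real line *)

Lemma is_derive_of_quadratic (f : R -> R) (x l c r : R) :
  0 < r -> 0 <= c ->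
  (forall y, Rabs (y - x) < r -> Rabs (f y - f x - (y - x) * l) <= c * Rabs (y - x) ^ 2) ->
  is_derive f x l.
Proof.
  intros hr hc h. apply is_derive_Reals. intros eps heps.
  assert (hd : 0 < Rmin r (eps / (c + 1))).
  { apply Rmin_glb_lt; [exact hr|]. apply Rdiv_lt_0_compat; lra. }
  exists (mkposreal _ hd). intros y hy hlt. simpl in hlt.
  assert (h1 := Rmin_l r (eps / (c + 1))). assert (h2 := Rmin_r r (eps / (c + 1))).
  assert (hb := h (x + y)). replace (x + y - x) with y in hb by ring.
  specialize (hb ltac:(lra)).
  assert (hpos : 0 < Rabs y) by now apply Rabs_pos_lt.
  replace ((f (x + y) - f x) / y - l) with ((f (x + y) - f x - y * l) * / y) by (field; exact hy).
  rewrite Rabs_mult, Rabs_inv.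
  apply Rle_lt_trans with (c * Rabs y).
  - apply Rmult_le_reg_r with (Rabs y); [exact hpos|].
    rewrite Rmult_assoc, Rinv_l by lra. rewrite Rmult_1_r.
    replace (c * Rabs y * Rabs y) with (c * Rabs y ^ 2) by ring. exact hb.
  - apply Rle_lt_trans with (c * (eps / (c + 1))); [apply Rmult_le_compat_l; lra|].
    apply Rlt_le_trans with ((c + 1) * (eps / (c + 1))); [|right; field; lra].
    apply Rmult_lt_compat_r; [|lra]. apply Rdiv_lt_0_compat; lra.
Qed.

Lemma C_diff_real_line (G : C -> C) (x : R) (l : C) :
  C_diff G (RtoC x) l ->
  is_derive (fun t : R => fst (G (RtoC t))) x (fst l) /\
  is_derive (fun t : R => snd (G (RtoC t))) x (snd l).
Proof.
  intros [c [r [hr [hc h]]]].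
  assert (hb : forall y : R, Rabs (y - x) < r ->
    Cmod (G (RtoC y) - G (RtoC x) - RtoC (y - x) * l) <= c * Rabs (y - x) ^ 2).
  { intros y hy. rewrite <- (Cmod_R (y - x)), RtoC_minus. apply h.
    now rewrite <- RtoC_minus, Cmod_R. }
  split; apply (is_derive_of_quadratic _ _ _ c r hr hc); intros y hy;
    (eapply Rle_trans; [|exact (hb y hy)]);
    (eapply Rle_trans; [|apply Rmax_Cmod]).
  - eapply Rle_trans; [|apply Rmax_l]. right. f_equal. simpl. ring.
  - eapply Rle_trans; [|apply Rmax_r]. right. f_equal. simpl. ring.
Qed.

Lemma is_derive_within_pair (D : R -> Prop) (f g df dg : R -> R) (t : R) :
  D t -> D_in f df D t -> D_in g dg D t ->
  is_derive_within D (fun t => (f t, g t)) t (df t, dg t).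
Proof.
  intros ht hf hg. split.
  { apply (@is_linear_scal_l R_AbsRing C_R_NormedModule). }
  intros x hx.
  (* [filterdiff] quantifies over the limit points of the filter. Since [t] lies in [D], every set
     of the filter contains [t], which leaves [t] as the only limit point. *)
  assert (ext : x = t).
  { destruct (Req_dec x t) as [e|ne]; [exact e|exfalso].
    assert (hd : 0 < Rabs (x - t)) by (apply Rabs_pos_lt; lra).
    assert (hl : locally x (fun y : R => Rabs (y - x) < Rabs (x - t))).
    { exists (mkposreal _ hd). intros y hy. exact hy. }
    destruct (hx _ hl) as [del hdel].
    specialize (hdel t (ball_center t del) ht). rewrite Rabs_minus_sym in hdel. lra. }
  subst x. intros eps.
  assert (he : 0 < eps / 2) by (assert (h := cond_pos eps); lra).
  destruct (hf _ he) as [d1 [hd1 h1]]. destruct (hg _ he) as [d2 [hd2 h2]].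
  exists (mkposreal _ (Rmin_glb_lt _ _ _ hd1 hd2)). intros y hy hDy.
  change (Rabs (y - t) < Rmin d1 d2) in hy.
  assert (m1 := Rmin_l d1 d2). assert (m2 := Rmin_r d1 d2).
  (* The norm on pairs is Euclidean, hence at most the sum of the components; each is given half of
     [eps]. *)
  change (sqrt (Rabs (f y - f t - (y - t) * df t) ^ 2 + Rabs (g y - g t - (y - t) * dg t) ^ 2)
          <= eps * Rabs (y - t)).
  destruct (Req_dec t y) as [e|ne].
  { subst y. rewrite !Rminus_diag, !Rmult_0_l, !Rminus_diag, Rabs_R0.
    rewrite pow_i, Rplus_0_l, sqrt_0 by lia. lra. }
  assert (hpos : 0 < Rabs (y - t)) by (apply Rabs_pos_lt; lra).
  assert (conv : forall (k dk : R -> R) d,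
    Rabs (y - t) < d ->
    (forall x, D_x D t x /\ Rdist x t < d -> Rdist ((k x - k t) / (x - t)) (dk t) < eps / 2) ->
    Rabs (k y - k t - (y - t) * dk t) <= eps / 2 * Rabs (y - t)).
  { intros k dk d hyd hk. assert (hk' := hk y (conj (conj hDy ne) hyd)). unfold Rdist in hk'.
    replace (k y - k t - (y - t) * dk t) with (((k y - k t) / (y - t) - dk t) * (y - t))
      by (field; lra).
    rewrite Rabs_mult. apply Rmult_le_compat_r; lra. }
  assert (c1 := conv f df d1 ltac:(lra) h1). assert (c2 := conv g dg d2 ltac:(lra) h2).
  set (p := f y - f t - (y - t) * df t) in *. set (q := g y - g t - (y - t) * dg t) in *.
  assert (hp := Rabs_pos p). assert (hq := Rabs_pos q).
  apply Rle_trans with (sqrt ((Rabs p + Rabs q) ^ 2)); [apply sqrt_le_1_alt; nra|].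
  rewrite sqrt_pow2; lra.
Qed.

Theorem theorem3p9 (d : nat -> C) (M R0 : R) (hM : 0 < M) (hR0 : 1 < R0)
  (hd : forall n : nat,
      Cmod (d n) <= M * (INR (fact (2 * n)) / R0 ^ (2 * n)))
  (U : C -> Prop) (G : C -> C)
  (hUopen : open U)
  (hUneg : forall x : R, x <= 0 -> U (RtoC x))
  (hGan : analytic_on U G)
  (hGext : forall z : C, U z -> Cmod z < R0 ^ 2 / 4 ->
      @is_pseries C_AbsRing C_NormedModule (g_coeff d) z (G z))
  (K : R) (hK : 0 < K)
  (hGbound : forall (x : R) (n : nat), x <= 0 ->
      Cmod (C_derive_n G n (RtoC x)) <= K * Cmod (C_derive_n G n (RtoC 0)))
  (T1 T2 : R) (hT : T1 < T2) :
  exists (f : R -> C) (Df : nat -> R -> C),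
    smooth_on (fun t : R => T1 <= t <= T2) f Df /\
    (forall n : nat, Df n T1 = RtoC 0) /\
    (forall n : nat, Df n T2 = d n) /\
    exists M' : R, 0 < M' /\
      forall (n : nat) (t : R), T1 <= t <= T2 ->
        Cmod (Df n t) <= M' * (INR (fact (2 * n)) / R0 ^ (2 * n)).
Proof.
  assert (series0 : series_at G 0 (g_coeff d)).
  { destruct (locally_C_Cmod 0 U (hUopen _ (hUneg 0 (Rle_refl 0)))) as [r [hr hU]].
    assert (hR4 : 0 < R0 ^ 2 / 4) by (apply Rdiv_lt_0_compat; [apply pow_lt|]; lra).
    exists (Rmin r (R0 ^ 2 / 4)). split; [now apply Rmin_glb_lt|].
    intros z hz. assert (m1 := Rmin_l r (R0 ^ 2 / 4)). assert (m2 := Rmin_r r (R0 ^ 2 / 4)).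
    apply has_sum_of_is_pseries. replace (z - 0)%C with z in * by ring.
    apply hGext; [apply hU; replace (z - 0)%C with z by ring|]; lra. }
  (* The [n]-th derivative of [G] at 0 is [n!] times its coefficient, that is [d (n+1) / (n+1)!]. *)
  assert (at0 : forall n, (C_derive_n G n 0 * RtoC (INR (fact (S n))) = d (S n))%C).
  { intros n. rewrite (C_derive_n_at_0 _ _ n series0). unfold g_coeff.
    rewrite RtoC_mult. field. split; intros e; apply RtoC_inj in e; now apply INR_fact_neq_0 in e. }
  set (w := fun n (x : R) => C_derive_n G n (RtoC x)).
  assert (hw : forall n x, x <= 0 ->
    is_derive (fun t => fst (w n t)) x (fst (w (S n) x)) /\
    is_derive (fun t => snd (w n t)) x (snd (w (S n) x))).
  { intros n x hx. destruct (hGan _ (hUneg x hx)) as [a ha].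
    apply C_diff_real_line.
    now apply (series_at_derive (C_derive_n G n) (RtoC x) (Nat.iter n dcoef a)),
      series_at_derive_n, series_at_of_locally. }
  set (a := / R0 ^ 2).
  assert (ha : 0 < a) by (apply Rinv_0_lt_compat, pow_lt; lra).
  assert (ean : forall n, a ^ n * INR (fact (2 * n)) = INR (fact (2 * n)) / R0 ^ (2 * n)).
  { intros n. unfold a. rewrite pow_inv, <- pow_mult. apply Rmult_comm. }
  assert (bw : forall n x, x <= 0 ->
    Cmod (w n x) * INR (fact (S n)) <= K * M * (a ^ S n * INR (fact (2 * S n)))).
  { intros n x hx. assert (hf := INR_fact_lt_0 (S n)).
    apply Rle_trans with (K * Cmod (C_derive_n G n 0) * INR (fact (S n))).
    - apply Rmult_le_compat_r; [lra | now apply hGbound].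
    - rewrite Rmult_assoc. rewrite <- (Rabs_pos_eq (INR (fact (S n)))) by lra.
      rewrite <- Cmod_R, <- Cmod_mult, at0, ean, Rmult_assoc.
      apply Rmult_le_compat_l; [lra | apply hd]. }
  assert (hKM : 0 <= K * M) by (apply Rmult_le_pos; lra).
  destruct (gevrey_borel_flat (fun n => fst (d n)) (fun n x => fst (w n x)) a (K * M) T1 T2)
    as [f1 [M1 [D1 [L1 [V1 [P1 B1]]]]]]; auto.
  { intros n x hx. now apply hw. }
  { intros n x hx. eapply Rle_trans; [|now apply (bw n x)].
    apply Rmult_le_compat_r; [apply pos_INR|]. eapply Rle_trans; [apply Rmax_l | apply Rmax_Cmod]. }
  { intros n. rewrite <- at0. simpl. unfold w. ring. }
  destruct (gevrey_borel_flat (fun n => snd (d n)) (fun n x => snd (w n x)) a (K * M) T1 T2)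
    as [f2 [M2 [D2 [L2 [V2 [P2 B2]]]]]]; auto.
  { intros n x hx. now apply hw. }
  { intros n x hx. eapply Rle_trans; [|now apply (bw n x)].
    apply Rmult_le_compat_r; [apply pos_INR|]. eapply Rle_trans; [apply Rmax_r | apply Rmax_Cmod]. }
  { intros n. rewrite <- at0. simpl. unfold w. ring. }
  exists (fun t => (f1 O t, f2 O t)), (fun n t => (f1 n t, f2 n t)).
  split; [split; [reflexivity|]|split; [|split]].
  - intros n t ht. apply is_derive_within_pair; [exact ht | now apply D1 | now apply D2].
  - intros n. now rewrite L1, L2.
  - intros n. rewrite V1, V2. now destruct (d n).
  (* The modulus is bounded by the sum of the two components; the added 1 makes the constant
     strictly positive, as [M1] and [M2] are only known to be nonnegative. *)
  - exists (M1 + M2 + 1). split; [lra|]. intros n t ht. rewrite <- ean.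
    replace (f1 n t, f2 n t) with (RtoC (f1 n t) + Ci * RtoC (f2 n t))%C
      by (unfold Ci, RtoC, Cplus, Cmult; simpl; f_equal; ring).
    eapply Rle_trans; [apply Cmod_triangle|].
    rewrite Cmod_mult, Cmod_Ci, !Cmod_R, Rmult_1_l.
    assert (b1 := B1 n t ht). assert (b2 := B2 n t ht).
    assert (0 <= a ^ n * INR (fact (2 * n)))
      by (apply Rmult_le_pos; [apply pow_le; lra | apply pos_INR]).
    lra.
Qed.
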